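(* Let $n\ge2$ and let $G$ be the disjoint union of $n$ copies of $K_2$ (a matching on $2n$ vertices, i.e. a chord diagram of size $n$). Let $X$ be the number of crossings in a uniformly random embedding of $G$, and let $W=\frac{X-E(X)}{\sqrt{\mathrm{Var}(X)}}$. Then $E(X)=\frac{n(n-1)}{6}$, $\mathrm{Var}(X)=\frac{n(n-1)(n+3)}{45}$, and $$d_K(W,Z)\le\frac{1868}{\sqrt n},$$ where $Z$ is a standard normal random variable.
   Context: Let $G=(V,E)$ be a finite simple graph with vertex set $V=[N]=\{1,\dots,N\}$. For a permutation $\pi\in S_N$, the embedding $G_\pi$ is the graph on $[N]$ in which $(\pi(v),\pi(w))$ is an edge if and only if $(v,w)\in E$. A crossing in $G_\pi$ is a quadruple $(a,b,c,d)$ of vertices with $(a,b),(c,d)\in E$ and $\pi(a)>\pi(c)>\pi(b)>\pi(d)$. A uniformly random embedding of $G$ is $G_\pi$ with $\pi$ uniformly random in $S_N$. The Kolmogorov distance between real random variables is $d_K(X,Y)=\sup_{x\in\mathbb{R}}|P(X\le x)-P(Y\le x)|$. *)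

(* Defs.v *)
From HB Require Import structures.
From mathcomp Require Import all_boot all_order all_algebra all_fingroup.
From mathcomp Require Import all_classical all_reals all_analysis measurable_realfun.

Set Implicit Arguments.
Unset Strict Implicit.
Unset Printing Implicit Defensive.

Import Order.TTheory GRing.Theory Num.Theory.
Import numFieldNormedType.Exports.

Local Open Scope classical_set_scope.
Local Open Scope ring_scope.

Record sgraph (V : finType) := SGraph {
  adj :> rel V;
  adj_sym : symmetric adj;
  adj_irr : irreflexive adj }.

Definition complete_graph (m : nat) : sgraph 'I_m.
Proof.
by exists (fun x y => x != y) => [x y|x]; [rewrite eq_sym|rewrite eqxx].
Defined.

Definition disjoint_copies (n : nat) (V : finType) (H : sgraph V) :
  sgraph ('I_n * V)%type.
Proof.
exists (fun p q => (p.1 == q.1) && H p.2 q.2) => [p q|p].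
  by rewrite eq_sym adj_sym.
by rewrite adj_irr andbF.
Defined.

Definition isomorphic (V V' : finType) (G : sgraph V) (H : sgraph V') : Prop :=
  exists f : V -> V', bijective f /\ forall x y, H (f x) (f y) = G x y.

(* The crossings of the embedding G_pi.  Every unordered pair of crossing edges
   is listed by exactly one such quadruple. *)
Definition crossings (N : nat) (G : sgraph 'I_N) (pi : 'S_N) :
    {set 'I_N * 'I_N * 'I_N * 'I_N} :=
  [set q | let: (a, b, c, d) := q in
    [&& G a b, G c d, (pi a > pi c)%N, (pi c > pi b)%N & (pi b > pi d)%N]]%SET.

(* Permutations carry the discrete sigma-algebra, so that a random permutation
   is a random variable in the sense of the library. *)
HB.instance Definition _ (T : finType) := isPointed.Build (perm_type T) (1%g : {perm T}).
HB.instance Definition _ (T : finType) :=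
  @isMeasurable.Build default_measure_display (perm_type T) discrete_measurable
    discrete_measurable0 discrete_measurableC discrete_measurableU.

Definition crossing_count (R : realType) (N : nat) (G : sgraph 'I_N) :
  'S_N -> R := fun pi => #|crossings G pi|%:R.

Lemma measurable_crossing_count (R : realType) (N : nat) (G : sgraph 'I_N) :
  measurable_fun [set: 'S_N] (crossing_count R G).
Proof. by []. Qed.

HB.instance Definition _ (R : realType) (N : nat) (G : sgraph 'I_N) :=
  isMeasurableFun.Build _ _ _ _ (crossing_count R G)
    (@measurable_crossing_count R N G).

Section RandomVariables.
Context {d : measure_display} {T : measurableType d} {R : realType}
  {P : probability T R}.

Definition uniform_permutation (N : nat) (pi : {RV P >-> 'S_N}) : Prop :=
  forall s : 'S_N, distribution P pi [set s] = ((N`!)%:R^-1)%:E.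

Definition crossing_number (N : nat) (G : sgraph 'I_N) (pi : {RV P >-> 'S_N}) :
  {RV P >-> R} := crossing_count R G \o pi.

Definition standardize (X : {RV P >-> R}) : T -> R :=
  fun w => (X w - fine 'E_P[X]) / Num.sqrt (fine 'V_P[X]).

Lemma measurable_standardize (X : {RV P >-> R}) :
  measurable_fun [set: T] (standardize X).
Proof. by apply: measurable_funM => //; exact: measurable_funB. Qed.

HB.instance Definition _ (X : {RV P >-> R}) :=
  isMeasurableFun.Build _ _ _ _ (standardize X) (measurable_standardize X).

Definition standard_normal (Z : {RV P >-> R}) : Prop :=
  forall A : set R, measurable A -> distribution P Z A = normal_prob 0 1 A.

End RandomVariables.

(* The two random variables may live on different probability spaces. *)
Definition kolmogorov_distance (R : realType)
    (d : measure_display) (T : measurableType d) (P : probability T R)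
    (d' : measure_display) (T' : measurableType d') (P' : probability T' R)
    (X : {RV P >-> R}) (Y : {RV P' >-> R}) : \bar R :=
  ereal_sup (range (fun x : R => `|cdf X x - cdf Y x|%E)).

(* Main.v *)
Require Import Defs.
From HB Require Import structures.
From mathcomp Require Import all_boot all_order all_algebra all_fingroup.
From mathcomp Require Import all_classical all_reals all_analysis measurable_realfun.
From mathcomp Require Import ring lra zify.

Set Implicit Arguments.
Unset Strict Implicit.
Unset Printing Implicit Defensive.

Import Order.TTheory GRing.Theory Num.Theory.
Import numFieldNormedType.Exports.

Local Open Scope classical_set_scope.
Local Open Scope ring_scope.

(** The proof is Stein's method with an exchangeable pair, carried out on a finite
    probability space on which all moments are exact.

    Give every pair of chords p, q the sign y_pq = -1 if they cross and 1
    otherwise, so that X - n (n - 1) / 6 is - 1 / 4 times the sum of y_ij - 1 / 3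
    over the ordered pairs of distinct chords.  Under a uniformly random order of
    the endpoints, functions of disjoint sets of chords are independent
    (avg_independent), and a product of k signs that share one chord and are
    otherwise disjoint has mean 1 / (2 k + 1) (avg_prod_crossing_sign).  Hence
    y_pq has mean 1 / 3 and covariance 4 / 45 with y_pr, which gives the variance
    of every weighted sum of signs (variance_crossing_form), in particular that
    of X.

    For the normal approximation, m = n^2 fresh chords are added to the diagram,
    and a chord i of the diagram is exchanged with a fresh chord r.  This does not
    change the law of the order, alters X by at most n - 1, and the mean increment
    over r, summed over i, is - (X - E X) up to a drift.  In the drift the
    projections on the chords of the diagram cancel, so it is of order n, against
    a standard deviation of order n^(3/2) (drift_second_moment).  The sum of the
    squared increments concentrates because its terms are independent unless they
    share a chord (variance_squared_increments).

    Stein's equation turns these facts into a bound on the Kolmogorov distance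
    (stein_exchangeable_pair).  Its solution and the derivative of the solution are
    bounded, but the derivative jumps at the threshold z, so one has to know how
    often W = (X - E X) / sigma is near z; the same exchangeable pair, tested
    against a clipped identity function, answers that (concentration).  The
    increments of W are at most 7 / sqrt n, its drift is at most 3 / sqrt n in L^2,
    and its quadratic variation is within 114 / sqrt n of 1 in L^1, so that the
    total is below 1868 / sqrt n (kolmogorov_diagram). *)

(** * The Gaussian distribution function and Stein's equation *)

Section Gaussian.
Context {R : realType}.
Implicit Types (x w z a b t : R).

Lemma mean_value (f df : R -> R) a b : a < b ->
  (forall x, is_derive x 1 f (df x)) ->
  exists c, [/\ a < c, c < b & f b - f a = df c * (b - a)].
Proof.
move=> ab fdf.
have cf : {within `[a, b], continuous f}.
  apply: continuous_subspaceT => x.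
  by apply/differentiable_continuous/derivable1_diffP; case: (fdf x).
have [c] := MVT ab (fun x _ => fdf x) cf.
by rewrite in_itv/= => /andP[ac cb] E; exists c.
Qed.

Lemma le_of_derive_ge0 (f df : R -> R) a b : a <= b ->
  (forall x, is_derive x 1 f (df x)) ->
  (forall x, a < x < b -> 0 <= df x) -> f a <= f b.
Proof.
rewrite le_eqVlt => /predU1P[->//|ab fdf df0].
have [c [ac cb E]] := mean_value ab fdf.
by rewrite -subr_ge0 E mulr_ge0 ?df0 ?ac//; lra.
Qed.

Definition gauss_density x : R := normal_pdf 0 1 x.
Definition gauss_cdf x : R := fine (normal_prob (0 : R) 1 `]-oo, x]).

Local Notation phi := gauss_density.
Local Notation Phi := gauss_cdf.

Lemma gauss_densityE x :
  phi x = normal_peak 1 * expR (- (x ^+ 2 / 2)).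
Proof.
rewrite /gauss_density normal_pdfE ?oner_eq0// /normal_fun subr0 expr1n.
by rewrite mulNr mulr2n.
Qed.

Lemma gauss_density_gt0 x : 0 < phi x.
Proof. by rewrite gauss_densityE mulr_gt0 ?expR_gt0 ?normal_peak_gt0 ?oner_eq0. Qed.

Lemma gauss_density0 : 1 <= 3 * phi 0.
Proof.
rewrite gauss_densityE expr0n/= mul0r oppr0 expR0 mulr1 /normal_peak expr1n mul1r.
have pi4 : (pi : R) < 4 by have := @pihalf_lt2 R; lra.
have pi0 := @pi_gt0 R.
have s0 : 0 < Num.sqrt ((pi : R) *+ 2) by rewrite sqrtr_gt0 mulr2n; lra.
rewrite ler_pdivlMr// mul1r -(@ler_pXn2r _ 2) ?nnegrE ?ltW//.
by rewrite sqr_sqrtr ?mulr2n; lra.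
Qed.

Global Instance is_derive_gauss_density x :
  is_derive x 1 phi (- x * phi x).
Proof.
have -> : phi = (fun x => normal_peak 1 * expR (- (x ^+ 2 / 2))).
  by apply/funext => y; exact: gauss_densityE.
apply: is_derive_eq.
by rewrite /GRing.scale/= mulr0; field.
Qed.

Global Instance is_derive_gauss_cdf x : is_derive x 1 Phi (phi x).
Proof.
have [||||dF FE] := @continuous_FTC1 R phi -oo%O x (x + 1).
- by rewrite ltrDl.
- exact: (integrableS _ _ (@subsetT _ _) (integrable_normal_pdf 0 1)).
- by rewrite ltNyr.
- by apply: continuous_normal_pdf; exact: oner_neq0.
split; first exact: dF.
by rewrite -derive1E; exact: FE.
Qed.

Lemma gauss_cdf_ge0 x : 0 <= Phi x.
Proof. exact: fine_ge0. Qed.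

Lemma gauss_cdf_le1 x : Phi x <= 1.
Proof.
by rewrite -lee_fin fineK ?fin_num_measure// probability_le1.
Qed.

Let idN : measurableTypeR R -> R := idfun.
Local HB.instance Definition _ :=
  @isMeasurableFun.Build _ _ _ _ idN (@measurable_id _ _ setT).

Lemma cvg_gauss_cdf_Ny e : 0 < e -> exists a, forall b, b <= a -> Phi b < e.
Proof.
move=> e0.
have /fine_cvgP[_ /cvgrPdist_lt /(_ _ e0) [M [_ H]]] :=
  cvg_cdfNy0 (idN : {RV (normal_prob (0:R) 1) >-> R}).
exists (M - 1) => b bM.
have := H b ltac:(by lra).
by rewrite sub0r normrN ger0_norm// fine_ge0.
Qed.

Lemma cvg_gauss_cdf_y e : 0 < e -> exists a, forall b, a <= b -> 1 - Phi b < e.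
Proof.
move=> e0.
have /fine_cvgP[_ /cvgrPdist_lt /(_ _ e0) [M [_ H]]] :=
  cvg_cdfy1 (idN : {RV (normal_prob (0:R) 1) >-> R}).
exists (M + 1) => b bM.
have := H b ltac:(by lra).
by apply: le_lt_trans; rewrite ler_norm.
Qed.


(** Mills' inequality: on the left of w one has |w| <= |x| and x phi(x) is a
    derivative, so |w| Phi(w) is at most the integral phi(w) of |x| phi(x). *)
Lemma mills_left w : w <= 0 -> - w * Phi w <= phi w.
Proof.
move=> w0; apply/ler_addgt0Pr => e e0.
have [a Ha] := @cvg_gauss_cdf_Ny (e / (1 - w)) ltac:(by rewrite divr_gt0//; lra).
pose a' := Num.min a w.
have a'w : a' <= w by rewrite ge_min lexx orbT.
have : phi a' - w * (- Phi a') <= phi w - w * (- Phi w).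
  apply: (@le_of_derive_ge0 (fun x => phi x - w * (- Phi x))
    (fun x => (w - x) * phi x)) => // [x|x /andP[_ xw]].
    by apply: is_derive_eq; rewrite /GRing.scale/=; ring.
  by rewrite mulr_ge0// ?subr_ge0 ?ltW// gauss_density_gt0.
have := @gauss_density_gt0 a'.
have : - w * Phi a' <= e.
  have H : Phi a' < e / (1 - w) by apply: Ha; rewrite ge_min lexx.
  have H1 : (1 - w) * Phi a' <= e by rewrite mulrC -ler_pdivlMr ?ltW//; lra.
  by have := gauss_cdf_ge0 a'; nra.
lra.
Qed.

Lemma mills_right w : 0 <= w -> w * (1 - Phi w) <= phi w.
Proof.
move=> w0; apply/ler_addgt0Pr => e e0.
have [a Ha] := @cvg_gauss_cdf_y (e / (1 + w)) ltac:(by rewrite divr_gt0//; lra).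
pose a' := Num.max a w.
have a'w : w <= a' by rewrite le_max lexx orbT.
have : - phi w - w * Phi w <= - phi a' - w * Phi a'.
  apply: (@le_of_derive_ge0 (fun x => - phi x - w * Phi x)
    (fun x => (x - w) * phi x)) => // [x|x /andP[xw _]].
    by apply: is_derive_eq; rewrite /GRing.scale/=; ring.
  by rewrite mulr_ge0// ?subr_ge0 ?ltW// gauss_density_gt0.
have := @gauss_density_gt0 a'.
have : w * (1 - Phi a') <= e.
  have H : 1 - Phi a' < e / (1 + w) by apply: Ha; rewrite le_max lexx.
  have H1 : (1 + w) * (1 - Phi a') <= e by rewrite mulrC -ler_pdivlMr ?ltW//; lra.
  by have := gauss_cdf_le1 a'; nra.
lra.
Qed.

Lemma is_derive_div_density (g dg : R -> R) x : (forall y : R, is_derive y 1 g (dg y)) ->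
  is_derive x 1 (fun y => g y / phi y) (x * (g x / phi x) + dg x / phi x).
Proof.
move=> H; have p0 : phi x != 0 by rewrite gt_eqF ?gauss_density_gt0.
apply: is_derive_eq; rewrite /GRing.scale/=.
by field.
Qed.

(** The Mills ratio Phi / phi has derivative 1 + w Phi(w) / phi(w), which
    Mills' inequality shows to be nonnegative, so it is largest at 0. *)
Lemma mills_ratio_left w : w <= 0 -> Phi w / phi w <= 3.
Proof.
move=> w0.
have : Phi w / phi w <= Phi 0 / phi 0.
  apply: (@le_of_derive_ge0 (fun x => Phi x / phi x)
     (fun x => x * (Phi x / phi x) + phi x / phi x)) => // [x|x /andP[_ x0]].
    exact: is_derive_div_density.
  rewrite mulrA -mulrDl divr_ge0// ?(ltW (gauss_density_gt0 _))//.
  by have := mills_left (ltW x0); lra.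
move=> /le_trans; apply; rewrite ler_pdivrMr ?gauss_density_gt0//.
exact: le_trans (gauss_cdf_le1 _) (gauss_density0).
Qed.

Lemma mills_ratio_right w : 0 <= w -> (1 - Phi w) / phi w <= 3.
Proof.
move=> w0.
have : - ((1 - Phi 0) / phi 0) <= - ((1 - Phi w) / phi w).
  apply: (@le_of_derive_ge0 (fun x => - ((1 - Phi x) / phi x))
     (fun x => - (x * ((1 - Phi x) / phi x) + (- phi x) / phi x)) 0 w w0) => [x|x /andP[x0 _]].
    have D (y : R) : is_derive y 1 (fun y => 1 - Phi y) (- phi y).
      by apply: is_derive_eq; rewrite add0r mul1r.
    exact: is_deriveN (is_derive_div_density x D).
  rewrite mulrA -mulrDl oppr_ge0 -oppr_ge0 -mulNr divr_ge0// ?(ltW (gauss_density_gt0 _))//.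
  by have := mills_right (ltW x0); lra.
rewrite lerN2 => /le_trans; apply; rewrite ler_pdivrMr ?gauss_density_gt0//.
apply: le_trans (gauss_density0).
by have := gauss_cdf_ge0 0; lra.
Qed.

Lemma gauss_cdf_homo a b : a <= b -> Phi a <= Phi b.
Proof.
move=> ab; apply: le_of_derive_ge0 ab _ _ => x _.
exact: (ltW (gauss_density_gt0 _)).
Qed.

(** The bounded solution of Stein's equation
    f'(w) - w f(w) = 1_(w <= z) - Phi(z). *)
Definition stein_sol z w : R :=
  if w <= z then (1 - Phi z) * (Phi w / phi w)
  else Phi z * ((1 - Phi w) / phi w).

(** Away from the kink at z this is the derivative of the solution. *)
Definition stein_sol' z w : R := w * stein_sol z w + (w <= z)%R%:R - Phi z.

(** Monotonicity of Phi moves z to w or to the larger side of 0, where the factor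
    that is divided by phi is a tail controlled by the Mills ratio. *)
Lemma stein_sol_bound z w : 0 <= stein_sol z w <= 3.
Proof.
have P0 := gauss_cdf_ge0; have P1 := gauss_cdf_le1.
have p0 := @gauss_density_gt0.
have q0 x : 0 <= Phi x / phi x by rewrite divr_ge0// ltW.
have q1 x : 0 <= (1 - Phi x) / phi x by rewrite divr_ge0 ?subr_ge0 ?P1// ltW.
have key x y : x <= y -> (1 - Phi y) * (Phi x / phi x) <= 3 /\ Phi x * ((1 - Phi y) / phi y) <= 3.
  move=> xy; have := gauss_cdf_homo xy.
  have [x0|x0] := leP x 0.
    have L := mills_ratio_left x0; split.
      by have := q0 x; have := P0 y; nra.
    have [y0|y0] := leP y 0.
      have -> : Phi x * ((1 - Phi y) / phi y) = (Phi x / phi y) * (1 - Phi y) by ring.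
      have H3 : Phi x / phi y <= 3.
        apply: le_trans (mills_ratio_left y0).
        by rewrite ler_pM2r ?invr_gt0.
      have H4 : 0 <= Phi x / phi y by rewrite divr_ge0// ltW.
      by have := P1 y; have := P0 y; nra.
    have := mills_ratio_right (ltW y0); have := q1 y.
    by have := P1 x; have := P0 x; nra.
  have y0 : 0 <= y by lra.
  have L := mills_ratio_right y0; split; last first.
    by have := q1 y; have := P1 x; have := P0 x; nra.
  have -> : (1 - Phi y) * (Phi x / phi x) = ((1 - Phi y) / phi x) * Phi x by ring.
  have H3 : (1 - Phi y) / phi x <= 3.
    apply: le_trans (mills_ratio_right (ltW x0)).
    by rewrite ler_pM2r ?invr_gt0//; lra.
  have H4 : 0 <= (1 - Phi y) / phi x by rewrite divr_ge0 ?subr_ge0 ?P1// ltW.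
  by have := P1 x; have := P0 x; nra.
rewrite /stein_sol; case: (leP w z) => wz.
  by rewrite mulr_ge0 ?subr_ge0//=; case: (key _ _ wz).
by rewrite mulr_ge0//=; case: (key _ _ (ltW wz)).
Qed.

(** On the left of z the derivative is 1 - Phi(z) + w f(w); Mills' inequality
    bounds w f(w) below by - (1 - Phi(z)) for w <= 0, and above by Phi(w) for
    w > 0.  The right side is symmetric. *)
Lemma stein_sol'_bound z w : `|stein_sol' z w| <= 1.
Proof.
have P0 := gauss_cdf_ge0; have P1 := gauss_cdf_le1.
have p0 := @gauss_density_gt0.
rewrite /stein_sol' /stein_sol ler_norml; case: (leP w z) => wz /=.
  have Pwz := gauss_cdf_homo wz.
  have -> : w * ((1 - Phi z) * (Phi w / phi w)) = (1 - Phi z) * (w * Phi w / phi w).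
    by ring.
  have [w0|w0] := leP w 0.
    have H1 : -1 <= w * Phi w / phi w.
      by rewrite ler_pdivlMr//; have := mills_left w0; lra.
    have H2 : w * Phi w / phi w <= 0.
      by rewrite pmulr_lle0 ?invr_gt0//; have := P0 w; nra.
    by move: (P0 z) (P1 z) => ? ?; apply/andP; split; nra.
  have H2 : (1 - Phi z) * (w * Phi w / phi w) <= Phi w.
    rewrite mulrA ler_pdivrMr//.
    have M := mills_right (ltW w0).
    have H3 : w * (1 - Phi z) <= phi w by nra.
    by have := P0 w; nra.
  have H1 : 0 <= w * Phi w / phi w.
    by rewrite divr_ge0 ?(ltW (p0 _))// mulr_ge0 ?P0// ltW.
  by move: (P0 z) (P1 z) => ? ?; apply/andP; split; nra.
have Pwz := gauss_cdf_homo (ltW wz).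
have -> : w * (Phi z * ((1 - Phi w) / phi w)) = Phi z * (w * (1 - Phi w) / phi w).
  by ring.
have [w0|w0] := leP 0 w.
  have H1 : w * (1 - Phi w) / phi w <= 1.
    by rewrite ler_pdivrMr//; have := mills_right w0; lra.
  have H2 : 0 <= w * (1 - Phi w) / phi w.
    by rewrite divr_ge0 ?(ltW (p0 _))// mulr_ge0// subr_ge0.
  by move: (P0 z) (P1 z) => ? ?; apply/andP; split; nra.
have H2 : - (1 - Phi w) <= Phi z * (w * (1 - Phi w) / phi w).
  rewrite mulrA ler_pdivlMr//.
  have M := mills_left (ltW w0).
  have H3 : - w * Phi z <= phi w by nra.
  by have := P1 w; nra.
have H1 : w * (1 - Phi w) / phi w <= 0.
  by rewrite pmulr_lle0 ?invr_gt0//; have := P1 w; nra.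
by move: (P0 z) (P1 z) => ? ?; apply/andP; split; nra.
Qed.

Lemma stein_sol_mean_value z a b : a < b -> b <= z \/ z <= a ->
  exists c, [/\ a < c, c < b & stein_sol z b - stein_sol z a = stein_sol' z c * (b - a)].
Proof.
move=> ab [bz|za].
  pose F w := (1 - Phi z) * (Phi w / phi w).
  have FE w : w <= z -> stein_sol z w = F w by rewrite /stein_sol => ->.
  have [c [ac cb E]] := @mean_value F
    (fun w => (1 - Phi z) * (w * (Phi w / phi w) + phi w / phi w)) a b ab
    (fun x => is_deriveZ (1 - Phi z) (is_derive_div_density x is_derive_gauss_cdf)).
  have p0 : phi c != 0 by rewrite gt_eqF ?gauss_density_gt0.
  exists c; split => //; rewrite !FE ?E /stein_sol' ?FE /F; [|lra..].
  have -> : c <= z by lra.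
  by congr (_ * _); rewrite /=; field.
pose F w := Phi z * ((1 - Phi w) / phi w).
have FE w : z <= w -> stein_sol z w = F w.
  rewrite le_eqVlt => /predU1P[<-|zw]; last by rewrite /stein_sol leNgt zw.
  by rewrite /stein_sol lexx /F; ring.
have D (y : R) : is_derive y 1 (fun w => 1 - Phi w) (- phi y).
  by apply: is_derive_eq; rewrite add0r mul1r.
have [c [ac cb E]] := @mean_value F
  (fun w => Phi z * (w * ((1 - Phi w) / phi w) + - phi w / phi w)) a b ab
  (fun x => is_deriveZ (Phi z) (is_derive_div_density x D)).
have p0 : phi c != 0 by rewrite gt_eqF ?gauss_density_gt0.
exists c; split => //; rewrite !FE ?E /stein_sol' ?FE /F; [|lra..].
have -> : (c <= z) = false by lra.
by congr (_ * _); rewrite /=; field.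
Qed.

Lemma stein_sol_lipschitz z a b : `|stein_sol z b - stein_sol z a| <= `|b - a|.
Proof.
have side x y : x <= y -> y <= z \/ z <= x ->
    `|stein_sol z y - stein_sol z x| <= y - x.
  rewrite le_eqVlt => /predU1P[->|xy H]; first by rewrite !subrr normr0.
  have [c [_ _ ->]] := stein_sol_mean_value xy H.
  by rewrite normrM (ger0_norm (_ : 0 <= y - x)) ?ler_piMl ?stein_sol'_bound; lra.
wlog ab : a b / a <= b.
  move=> H; have [|ba] := leP a b; first exact: H.
  by rewrite distrC (distrC b); apply: H; exact: ltW.
rewrite [leRHS]ger0_norm ?subr_ge0//.
have [bz|zb] := leP b z; first by apply: side => //; left.
have [za|az] := leP z a; first by apply: side => //; right.
have H1 := side a z (ltW az) (or_introl (lexx z)).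
have H2 := side z b (ltW zb) (or_intror (lexx z)).
have := ler_normD (stein_sol z b - stein_sol z z) (stein_sol z z - stein_sol z a).
by rewrite subrKA => /le_trans; apply; lra.
Qed.

(** Linearizing the solution costs a second-order term, because w f(w) is
    locally Lipschitz, and a first-order term only near the kink at z. *)
Lemma stein_sol_linearize z w t :
  `|t * stein_sol' z w - (stein_sol z (w + t) - stein_sol z w)| <=
  `|t| * ((`|w| + 3) * `|t| + 2 * (`|w - z| <= `|t|)%R%:R).
Proof.
have [near|far] := leP `|w - z| `|t|.
  have L := stein_sol_lipschitz z w (w + t).
  rewrite [w + t]addrC addrK in L.
  have B := stein_sol'_bound z w.
  apply: le_trans (ler_normB _ _) _.
  rewrite [w + t]addrC normrM.
  have := normr_ge0 t; have := normr_ge0 w; move: B L => /=.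
  set A := `|stein_sol' z w|; set C := `|_ - _|; move: A C => A C B L w0 t0.
  have : 0 <= `|t| * `|t| by nra.
  by nra.
rewrite mulr0 addr0.
have [->|t0] := eqVneq t 0; first by rewrite addr0 subrr mul0r subrr normr0 mul0r.
have [c [cw cz E]] : exists c, [/\ `|w - c| <= `|t|, (c <= z) = (w <= z)
    & stein_sol z (w + t) - stein_sol z w = stein_sol' z c * t].
  have [tp|tn] : 0 < t \/ t < 0.
    by case: (ltgtP t 0) t0 => // ? _; [right|left].
  - have H : w + t <= z \/ z <= w.
      move: far; rewrite (gtr0_norm tp); case: (leP w z) => ?; last by right; lra.
      by rewrite ler0_norm; [left; lra|lra].
    have [c [c1 c2 E]] := @stein_sol_mean_value z w (w + t) ltac:(lra) H.
    exists c; split; last by rewrite E; congr (_ * _); ring.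
      by rewrite (gtr0_norm tp) ler0_norm; lra.
    apply/idP/idP => ?; first by lra.
    case: H => // ?; first by lra.
    have wz : w = z by lra.
    by move: far; rewrite wz subrr normr0; move: (normr_ge0 t); lra.
  - have H : w <= z \/ z <= w + t.
      move: far; rewrite (ltr0_norm tn); case: (leP w z) => ?; first by left.
      by rewrite gtr0_norm; [right; lra|lra].
    have [c [c1 c2 E]] := @stein_sol_mean_value z (w + t) w ltac:(lra) H.
    exists c; split; last by rewrite -opprB E -mulrN; congr (_ * _); ring.
      by rewrite (ltr0_norm tn) ger0_norm; lra.
    apply/idP/idP => ?; last by lra.
    case: H => // ?; first by lra.
rewrite E (mulrC _ t) -mulrBr normrM ler_wpM2l// /stein_sol' cz.
have -> : w * stein_sol z w + (w <= z)%R%:R - Phi z -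
    (c * stein_sol z c + (w <= z)%R%:R - Phi z) =
    w * (stein_sol z w - stein_sol z c) + (w - c) * stein_sol z c by ring.
apply: le_trans (ler_normD _ _) _; rewrite !normrM.
have L := stein_sol_lipschitz z c w.
have /andP[s0 s3] := stein_sol_bound z c.
rewrite (ger0_norm s0).
have := normr_ge0 w; have := normr_ge0 t; move: L cw.
set A := `|stein_sol z w - _|; set B := `|w - c|; have := normr_ge0 (w - c); rewrite -/B.
by move: A B => A B B0 AB Bt t0' w0; nra.
Qed.

End Gaussian.

(** * Stein's method for an exchangeable pair on a finite space *)

Definition avg (R : realType) (I : finType) (f : I -> R) : R :=
  #|I|%:R^-1 * \sum_i f i.

Section Average.
Context {R : realType} {I : finType}.
Implicit Types (f g : I -> R) (a : R).

Lemma eq_avg f g : f =1 g -> avg f = avg g.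
Proof. by move=> fg; congr (_ * _); exact: eq_bigr. Qed.

Lemma avgD f g : avg (fun i => f i + g i) = avg f + avg g.
Proof. by rewrite /avg big_split mulrDr. Qed.

Lemma avgZ a f : avg (fun i => a * f i) = a * avg f.
Proof. by rewrite /avg -mulr_sumr mulrCA. Qed.

Lemma avgN f : avg (fun i => - f i) = - avg f.
Proof. by rewrite /avg sumrN mulrN. Qed.

Lemma avgB f g : avg (fun i => f i - g i) = avg f - avg g.
Proof. by rewrite avgD avgN. Qed.

Lemma le_avg f g : (forall i, f i <= g i) -> avg f <= avg g.
Proof. by move=> fg; rewrite ler_wpM2l ?invr_ge0// ler_sum. Qed.

Lemma avg_sum (J : finType) (P : pred J) (f : J -> I -> R) :
  avg (fun i => \sum_(j | P j) f j i) = \sum_(j | P j) avg (f j).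
Proof. by rewrite /avg exchange_big mulr_sumr. Qed.

Lemma avg_reindex (h : I -> I) f : injective h -> avg (f \o h) = avg f.
Proof. by move=> hI; rewrite /avg [in RHS](reindex_inj hI). Qed.

Lemma avg_norm f : `|avg f| <= avg (fun i => `|f i|).
Proof.
by rewrite normrM ger0_norm ?invr_ge0// ler_wpM2l ?invr_ge0// ler_norm_sum.
Qed.

Hypothesis I0 : (0 < #|I|)%N.

Lemma avg_cst a : avg (fun _ : I => a) = a.
Proof.
by rewrite /avg sumr_const -[X in _ * X]mulr_natl mulrA mulVf ?mul1r// pnatr_eq0 -lt0n.
Qed.

(** The mean of |f| is at most the root mean square, since
    2 |x| <= x^2 / r + r for every r > 0. *)
Lemma avg_norm_le f s : 0 <= s -> avg (fun i => f i ^+ 2) <= s ^+ 2 ->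
  avg (fun i => `|f i|) <= s.
Proof.
move=> s0 H; apply/ler_addgt0Pr => e e0; have s1 : 0 < s + e by lra.
have : avg (fun i => `|f i|) <=
    avg (fun i => (2 * (s + e))^-1 * f i ^+ 2 + (s + e) / 2).
  apply: le_avg => i; rewrite -(real_normK (num_real (f i))).
  move: `|f i| => x; rewrite -subr_ge0.
  have -> : (2 * (s + e))^-1 * x ^+ 2 + (s + e) / 2 - x =
    (2 * (s + e))^-1 * (x - (s + e)) ^+ 2 by field; rewrite gt_eqF.
  by rewrite mulr_ge0 ?sqr_ge0// invr_ge0; lra.
rewrite avgD avgZ avg_cst => /le_trans; apply.
have : (2 * (s + e))^-1 * avg (fun i => f i ^+ 2) <= (s + e) / 2.
  by rewrite ler_pdivrMl//; nra.
lra.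
Qed.

End Average.

Section SteinExchangeablePair.
Context {R : realType} {Omega J : finType}.
Variables (tau : J -> Omega -> Omega) (W T : Omega -> R) (c : R).
Hypothesis tauK : forall j, involutive (tau j).
Hypothesis c0 : 0 <= c.
Hypothesis regression : forall x, c * \sum_j (W (tau j x) - W x) = T x - W x.

Local Notation D j x := (W (tau j x) - W x).

Definition quadratic_variation x := c / 2 * \sum_j D j x ^+ 2.
Local Notation K := quadratic_variation.

(** Exchanging x and tau_j x turns the antisymmetric increment D_j into the
    regression of W. *)
Lemma exchangeable_identity (f : R -> R) :
  avg (fun x => c / 2 * \sum_j D j x * (f (W (tau j x)) - f (W x))) =
  avg (fun x => (W x - T x) * f (W x)).
Proof.
have swap j : avg (fun x => D j x * f (W (tau j x))) =
              - avg (fun x => D j x * f (W x)).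
  rewrite -avgN -(avg_reindex _ (inv_inj (tauK j))).
  by apply: eq_avg => x /=; rewrite tauK; ring.
rewrite avgZ avg_sum.
under eq_bigr do under eq_avg do rewrite mulrBr.
under eq_bigr do rewrite avgB swap.
have -> : avg (fun x => (W x - T x) * f (W x)) =
    - c * avg (fun x => \sum_j D j x * f (W x)).
  rewrite -avgZ; apply: eq_avg => x; rewrite -mulr_suml mulrA mulNr regression.
  by congr (_ * _); ring.
rewrite avg_sum !mulr_sumr; apply: eq_bigr => j _.
by field.
Qed.

Variables (delta kappa eta eps : R).
Hypothesis Omega0 : (0 < #|Omega|)%N.
Hypothesis D_le : forall j x, `|D j x| <= delta.
Hypothesis K_le : forall x, K x <= kappa.
Hypothesis K_near1 : avg (fun x => `|1 - K x|) <= eta.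
Hypothesis T_small : avg (fun x => `|T x|) <= eps.
Hypothesis W_norm : avg (fun x => `|W x|) <= 1.
Hypothesis delta0 : 0 <= delta.

(** Concentration: the test function is the identity clipped to a window of
    radius 2 delta, so that every pair starting within delta of z contributes
    its full squared increment and no pair contributes negatively. *)
Lemma concentration z :
  avg (fun x => K x * (`|W x - z| <= delta)%R%:R) <= 2 * delta * (1 + eps).
Proof.
have d_ge0 := delta0.
have dd : - (2 * delta) <= 2 * delta by lra.
pose f w : R := Num.max (- (2 * delta)) (Num.min (2 * delta) (w - z)).
have fb w : `|f w| <= 2 * delta.
  by rewrite ler_norml /f le_max lexx ge_max ge_min lexx/= andbT.
have f_id w : `|w - z| <= 2 * delta -> f w = w - z.
  by rewrite ler_norml /f => /andP[w1 w2]; rewrite min_r// max_r.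
have f_homo v w : v <= w -> f v <= f w.
  move=> vw; rewrite /f ge_max !le_max lexx/=; apply/orP; right.
  by rewrite le_min !ge_min lexx/= lerD2r vw orbT.
apply: (@le_trans _ _ (avg (fun x =>
    c / 2 * \sum_j D j x * (f (W (tau j x)) - f (W x))))).
  apply: le_avg => x; rewrite /quadratic_variation -mulrA ler_wpM2l ?divr_ge0//.
  rewrite mulr_suml; apply: ler_sum => j _; have := D_le j x.
  move: (W (tau j x)) (W x) => v w; rewrite ler_norml => dl.
  case: (leP `|w - z| delta) => /= wz.
    move: wz dl; rewrite ler_norml mulr1 => /andP[w1 w2] /andP[d1 d2].
    rewrite !f_id ?ler_norml ?expr2.
    - by rewrite opprB addrA subrK.
    - by apply/andP; split; lra.
    - by apply/andP; split; lra.
  rewrite mulr0; have [vw|/ltW vw] := leP v w.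
    by rewrite mulr_le0// subr_le0 ?f_homo.
  by rewrite mulr_ge0// subr_ge0 ?f_homo.
rewrite exchangeable_identity.
apply: (@le_trans _ _ (avg (fun x => 2 * delta * (`|W x| + `|T x|)))).
  apply: le_avg => x; apply: le_trans (ler_norm _) _.
  rewrite normrM mulrC ler_pM// ?fb//.
  exact: ler_normB.
rewrite avgZ avgD; apply: ler_wpM2l; first by lra.
by apply: lerD.
Qed.

(** The exchangeable identity, applied to the solution f of Stein's equation,
    leaves three errors: 1 - K against the derivative f', T against f, and the
    linearization of f along the increments, in which the kink at z weighs as
    little as W concentrates there. *)
Lemma stein_exchangeable_pair z :
  `|avg (fun x => (W x <= z)%R%:R) - gauss_cdf z| <=
  eta + 3 * eps + 4 * kappa * delta + 4 * delta * (1 + eps).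
Proof.
have d_ge0 := delta0; pose f := stein_sol z; pose f' := stein_sol' z.
have -> : avg (fun x => (W x <= z)%R%:R) - gauss_cdf z =
    avg (fun x => f' (W x) - W x * f (W x)).
  rewrite -[X in _ - X](avg_cst Omega0) -avgB; apply: eq_avg => x.
  by rewrite /f' /stein_sol' /f; ring.
have -> : avg (fun x => f' (W x) - W x * f (W x)) =
    avg (fun x => (1 - K x) * f' (W x) - T x * f (W x)
      + c / 2 * \sum_j D j x * (D j x * f' (W x) - (f (W (tau j x)) - f (W x)))).
  have E x : c / 2 * \sum_j D j x * (D j x * f' (W x) - (f (W (tau j x)) - f (W x)))
     = K x * f' (W x) - c / 2 * \sum_j D j x * (f (W (tau j x)) - f (W x)).
    rewrite /quadratic_variation -!mulrA -!mulrBr mulr_suml -sumrB; do 2!congr (_ * _).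
    by apply: eq_bigr => j _; ring.
  under [RHS]eq_avg do rewrite E addrA.
  rewrite [RHS]avgB (exchangeable_identity f) -[RHS]avgB.
  by apply: eq_avg => x; ring.
apply: le_trans (avg_norm _) _.
apply: (@le_trans _ _ (avg (fun x => `|1 - K x| + (3 * `|T x| +
    (delta * kappa * (`|W x| + 3) + 2 * (K x * (`|W x - z| <= delta)%R%:R)))))).
  apply: le_avg => x.
  have Ks : `|c / 2 * \sum_j D j x * (D j x * f' (W x) - (f (W (tau j x)) - f (W x)))|
     <= K x * ((`|W x| + 3) * delta + 2 * (`|W x - z| <= delta)%R%:R).
    rewrite normrM ger0_norm ?divr_ge0// /K -[leRHS]mulrA ler_wpM2l ?divr_ge0//.
    apply: le_trans (ler_norm_sum _ _ _) _; rewrite mulr_suml; apply: ler_sum => j _.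
    rewrite normrM -(real_normK (num_real (D j x))) expr2 -mulrA ler_wpM2l//.
    have := stein_sol_linearize z (W x) (D j x).
    rewrite (addrC (W x)) subrK => /le_trans; apply.
    apply: ler_wpM2l => //; apply: lerD.
      by apply: ler_wpM2l => //; rewrite addr_ge0.
    apply: ler_wpM2l => //; rewrite ler_nat; have := D_le j x.
    by case: (leP _ `|D j x|) => // H1 H2; rewrite (le_trans H1 H2).
  apply: le_trans (ler_normD _ _) _; apply: le_trans (lerD (ler_normB _ _) Ks) _.
  rewrite -addrA; apply: lerD.
    by rewrite normrM ler_piMr ?stein_sol'_bound.
  apply: lerD.
    rewrite normrM mulrC ler_wpM2r//; have /andP[? ?] := stein_sol_bound z (W x).
    by rewrite ger0_norm.
  rewrite mulrDr; apply: lerD; last by rewrite mulrCA.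
  have : 0 <= (`|W x| + 3) * delta by rewrite mulr_ge0// addr_ge0.
  by have := K_le x; nra.
rewrite !avgD !avgZ avgD (avg_cst Omega0).
have := concentration z.
have k0 : 0 <= kappa.
  have [x _] : exists x : Omega, x \in Omega by move/card_gt0P: Omega0.
  apply: le_trans (K_le x); rewrite mulr_ge0 ?divr_ge0// sumr_ge0// => j _.
  exact: sqr_ge0.
move: K_near1 T_small W_norm.
set a1 := avg _; set a2 := avg _; set a3 := avg _; set a4 := avg _.
have : 0 <= delta * kappa by rewrite mulr_ge0.
move: a1 a2 a3 a4 => a1 a2 a3 a4 dk H1 H2 H3 H4.
have : delta * kappa * (a3 + 3) <= delta * kappa * 4 by rewrite ler_wpM2l//; lra.
lra.
Qed.

End SteinExchangeablePair.

(** * Order patterns of a uniformly random permutation *)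

(** Among the rearrangements t of A, one that maximizes the sum of
    v a * u (t a) sorts u like v, by the rearrangement inequality. *)
Lemma exists_reordering (L : finType) (A : {set L}) (u v : L -> nat) :
  injective u -> injective v ->
  exists2 t : {perm L}, perm_on A t &
    {in A &, forall a b, (u (t a) < u (t b))%N = (v a < v b)%N}.
Proof.
move=> uI vI.
have on1 : perm_on A (1%g : {perm L}) by exact: perm_on1.
pose M (t : {perm L}) := (\sum_(a in A) v a * u (t a))%N.
case: (arg_maxnP M on1) => t tA tmax; exists t => //.
have key a b : a \in A -> b \in A -> (v a < v b)%N -> (u (t a) < u (t b))%N.
  move=> aA bA vab; rewrite ltnNge leq_eqVlt; apply/negP => /orP[/eqP/uI/perm_inj ba|tba].
    by move: vab; rewrite ba ltnn.
  have ab : a != b by apply: contraTneq vab => ->; rewrite ltnn.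
  have sA : perm_on A (tperm a b * t)%g.
    apply: perm_onM tA; apply/fintype.subsetP => x; rewrite inE.
    by case: tpermP => [->|->|_ _]//; rewrite eqxx.
  have := tmax _ sA; rewrite /= leqNgt => /negP; apply.
  rewrite /M (bigD1 a)//= (bigD1 b)/=; last by rewrite bA eq_sym.
  rewrite [X in (_ < X)%N](bigD1 a)//= [X in (_ < _ + X)%N](bigD1 b)/=; last first.
    by rewrite bA eq_sym.
  rewrite !permM tpermL tpermR.
  have -> : (\sum_(i | (i \in A) && (i != a) && (i != b)) v i * u ((tperm a b * t)%g i) =
             \sum_(i | (i \in A) && (i != a) && (i != b)) v i * u (t i))%N.
    by apply: eq_bigr => i /andP[/andP[_ ia] ib]; rewrite permM tpermD// eq_sym.
  rewrite !addnA ltn_add2r.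
  move: vab tba; move: (v a) (v b) (u (t a)) (u (t b)) => p q x y.
  by nia.
move=> a b aA bA; apply/idP/idP; last exact: key.
move=> H; rewrite ltnNge leq_eqVlt; apply/negP => /orP[/eqP/vI ba|vba].
  by move: H; rewrite ba ltnn.
by have := key _ _ bA aA vba; rewrite ltnNge (ltnW H).
Qed.

Section OrderPatterns.
Context {R : realType} {L : finType}.
Variable u : L -> nat.
Hypothesis uI : injective u.
Implicit Types (s t : {perm L}) (A B : {set L}) (F G : {perm L} -> R).

Definition same_order A s t :=
  {in A &, forall a b, (u (s a) < u (s b))%N = (u (t a) < u (t b))%N}.

Definition depends_on A F := forall s t, same_order A s t -> F s = F t.

Lemma perm_gt0 (K : finType) : (0 < #|{perm K}|)%N.
Proof. by apply/card_gt0P; exists 1%g. Qed.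

Lemma sum_relabel A F s s' : depends_on A F ->
  \sum_(t | perm_on A t) F (t * s)%g = \sum_(t | perm_on A t) F (t * s')%g.
Proof.
move=> FA.
have [t0 t0A H] := @exists_reordering L A (u \o s) (u \o s')
  (inj_comp uI perm_inj) (inj_comp uI perm_inj).
rewrite (reindex_inj (mulIg t0)) /=.
have onM t : perm_on A (t * t0)%g = perm_on A t.
  by apply/idP/idP => [tA|/perm_onM]; [rewrite -(mulgK t0 t) perm_onM// perm_onV|exact].
apply: eq_big => // t; rewrite onM => tA; apply: FA => a b aA bA.
by rewrite !permM; apply: H; rewrite perm_closed.
Qed.

(** The relative orders that a uniformly random permutation induces on disjoint
    sets are independent: rearranging A alone leaves the order on B unchanged,
    while averaging over these rearrangements makes F constant. *)
Lemma avg_independent A B F G : {in A, forall x, x \notin B} -> depends_on A F ->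
  depends_on B G -> avg (fun s => F s * G s) = avg F * avg G.
Proof.
move=> dAB FA GB.
pose C := \sum_(t | perm_on A t) F t.
pose k : R := \sum_(t | perm_on A t) 1.
have nA x : x \in B -> x \notin A by move=> xB; apply/negP => /dAB; rewrite xB.
have k0 : k != 0.
  rewrite /k sumr_const pnatr_eq0 -lt0n; apply/card_gt0P.
  by exists 1%g; exact: perm_on1.
have key G' : depends_on B G' -> k * avg (fun s => F s * G' s) = C * avg G'.
  move=> GB'; rewrite /k mulr_suml -[RHS]avgZ.
  have E t : perm_on A t ->
     1 * avg (fun s => F s * G' s) = avg (fun s => F (t * s)%g * G' s).
    move=> tA; rewrite mul1r -(avg_reindex _ (mulgI t)); apply: eq_avg => s /=.
    congr (_ * _); apply: GB' => a b aB bB; rewrite !permM.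
    by rewrite !(out_perm tA) ?nA.
  rewrite (eq_bigr _ E) -avg_sum; apply: eq_avg => s.
  rewrite -mulr_suml (sum_relabel s 1%g FA) /C.
  by under eq_bigr do rewrite mulg1.
have k1 := key (fun _ => 1) (fun _ _ _ => erefl).
rewrite (avg_cst (perm_gt0 L)) mulr1 in k1.
apply: (mulfI k0); rewrite key// [RHS]mulrA -k1; congr (_ * _ * _).
by apply: eq_avg => s; rewrite mulr1.
Qed.

End OrderPatterns.

Lemma extend_perm (L L' : finType) (e : L -> L') (t : {perm L}) :
  injective e -> exists t' : {perm L'}, forall a, t' (e a) = e (t a).
Proof.
move=> eI; pose g x := if [pick a | e a == x] is Some a then e (t a) else x.
have ge a : g (e a) = e (t a).
  by rewrite /g; case: pickP => [b /eqP/eI ->//|/(_ a)]; rewrite eqxx.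
have gI : injective g.
  move=> x y; rewrite /g; case: pickP => [a /eqP <-|ex]; case: pickP => [b /eqP <-|ey]//.
  - by move=> /eI /perm_inj ->.
  - by move=> E; have := ey (t a); rewrite E eqxx.
  - by move=> E; have := ex (t b); rewrite E eqxx.
by exists (perm gI) => a; rewrite permE ge.
Qed.

(** Restricting a uniformly random permutation of a larger set of labels gives a
    uniformly random order pattern. *)
Lemma avg_restrict (R : realType) (L L' : finType) (u : L -> nat) (u' : L' -> nat)
    (e : L -> L') (F : (L -> nat) -> R) :
  injective u -> injective u' -> injective e ->
  (forall v w, (forall a b, (v a < v b)%N = (w a < w b)%N) -> F v = F w) ->
  avg (fun s : {perm L'} => F (fun a => u' (s (e a)))) =
  avg (fun s : {perm L} => F (fun a => u (s a))).
Proof.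
move=> uI uI' eI FP.
rewrite -(avg_cst (perm_gt0 L) (avg (fun s : {perm L'} => _))).
transitivity (avg (fun t : {perm L} =>
    avg (fun s : {perm L'} => F (fun a => u' (s (e (t a))))))).
  apply: eq_avg => t; have [t' Et] := extend_perm t eI.
  rewrite -(avg_reindex _ (mulgI t')); apply: eq_avg => s /=; apply: FP => a b.
  by rewrite !permM !Et.
rewrite -[RHS](avg_cst (perm_gt0 L')) /avg.
under eq_bigr do rewrite mulr_sumr.
rewrite exchange_big mulr_sumr /= mulr_sumr; apply: eq_bigr => s _.
rewrite -mulr_sumr mulrCA; congr (_ * (_ * _)).
have [t0 _ H] := @exists_reordering L [set: L]%SET (fun a => u' (s (e a))) u
  (inj_comp uI' (inj_comp perm_inj eI)) uI.
rewrite (reindex_inj (mulIg t0)) /=; apply: eq_bigr => t _; apply: FP => a b.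
by rewrite !permM H ?inE.
Qed.

(** * Moments of the crossing signs *)

Section Signs.
Context {R : realType} {L : finType}.
Implicit Types (v : L -> nat) (A C : {set L}).

Definition sgn v x y : R := (-1) ^+ (v x < v y)%N.

Lemma sgn_sqr v x y : sgn v x y * sgn v x y = 1.
Proof. by rewrite /sgn -expr2 sqrr_sign. Qed.

Lemma sgn_antisym v x y : injective v -> x != y -> sgn v y x = - sgn v x y.
Proof.
move=> vI xy; rewrite /sgn ltnNge leq_eqVlt (inj_eq vI) (negPf xy) /= signrN.
by [].
Qed.

(** The sign of x in A tells the parity of the number of larger elements. *)
Definition rank_sign v A x : R := \prod_(y in A | y != x) sgn v x y.

(** The signs of the elements of A alternate along the order. *)
Lemma sum_rank_sign v A : injective v ->
  \sum_(x in A) rank_sign v A x = (odd #|A|)%:R.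
Proof.
move=> vI; move En: #|A| => n; elim: n A En => [|n IH] A cA.
  by rewrite big_pred0// => x; move/eqP: cA; rewrite cards_eq0 => /eqP ->; rewrite inE.
have [x0 x0A] : exists x, x \in A by apply/card_gt0P; rewrite cA.
have [M MA Mmax] : exists2 M, M \in A & forall y, y \in A -> (v y <= v M)%N.
  by case: (@arg_maxnP _ x0 (mem A) v x0A) => M ? ?; exists M.
have cAM : #|(A :\ M)%SET| = n by move: (cardsD1 M A); rewrite MA cA => -[->].
rewrite (bigD1 M)//= {1}/rank_sign big1 => [|y /andP[yA yM]]; last first.
  by rewrite /sgn ltnNge Mmax.
have -> : \sum_(x in A | x != M) rank_sign v A x =
          - \sum_(x in (A :\ M)%SET) rank_sign v (A :\ M)%SET x.
  rewrite -sumrN; apply: eq_big => [x|x /andP[xA xM]].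
    by rewrite !inE andbC.
  rewrite /rank_sign (bigD1 M)/=; last by rewrite MA eq_sym.
  have -> : sgn v x M = -1.
    have := Mmax _ xA; rewrite leq_eqVlt => /orP[/eqP/vI E|E].
      by rewrite E eqxx in xM.
    by rewrite /sgn E.
  rewrite mulN1r; congr (- _); apply: eq_bigl => y.
  by rewrite !inE; case: (y \in A); case: (y == M); case: (y == x).
by rewrite IH// /=; case: (odd n); rewrite ?subrr ?subr0.
Qed.

End Signs.

Section SignMoments.
Context {R : realType} {L : finType}.
Variable u : L -> nat.
Hypothesis uI : injective u.
Implicit Types (s t : {perm L}) (C : {set L}).

Local Notation sg s := (@sgn R L (u \o s)).

Lemma uperm_inj s : injective (u \o s).
Proof. exact: inj_comp uI perm_inj. Qed.

(** Multiplying the rank signs of a and b in a |: (b |: C) leaves minus the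
    product of the separations, so the average of the latter over all pairs is
    read off from the vanishing sum of the rank signs. *)
Lemma avg_separation a b C : a \notin C -> b \notin C -> a != b ->
  ~~ odd #|C| ->
  avg (fun s => \prod_(x in C) (sg s a x * sg s b x)) = (#|C|%:R + 1)^-1.
Proof.
move=> aC bC ab eC.
pose A := (a |: (b |: C))%SET.
pose Z x y s := \prod_(z in A | (z != x) && (z != y)) (sg s x z * sg s y z).
have cA : #|A| = #|C|.+2 by rewrite !cardsU1 !inE negb_or ab aC bC.
have aA : a \in A by rewrite !inE eqxx.
have bA : b \in A by rewrite !inE eqxx orbT.
have ZE x y s : x \in A -> y \in A -> x != y ->
    Z x y s = - (rank_sign (u \o s) A x * rank_sign (u \o s) A y).
  move=> xA yA xy; rewrite /rank_sign.
  rewrite (bigD1 y)/=; last by rewrite yA eq_sym.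
  rewrite [X in _ * X](bigD1 x)/=; last by rewrite xA.
  rewrite (sgn_antisym (@uperm_inj s) xy).
  rewrite /Z big_split /=.
  set P1 := \prod_(_ | _) _; set P2 := \prod_(_ | _) _.
  set P3 := \prod_(_ | _) _; set P4 := \prod_(_ | _) _.
  have -> : P3 = P1.
    by apply: eq_bigl => i; case: (i \in A); case: (i == x); case: (i == y).
  have -> : P4 = P2.
    by apply: eq_bigl => i; case: (i \in A); case: (i == x); case: (i == y).
  rewrite -[P1 * P2]mul1r -(sgn_sqr (u \o s) x y); ring.
have Zinv x y : x \in A -> y \in A -> x != y -> avg (Z x y) = avg (Z a b).
  move=> xA yA xy.
  pose t := (tperm a x * tperm (tperm a x b) y)%g.
  have b'A : tperm a x b \in A by case: tpermP.
  have xb' : x != tperm a x b by rewrite -[X in X != _](tpermL a x) (inj_eq perm_inj).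
  have ta : t a = x by rewrite permM tpermL tpermD 1?eq_sym// eq_sym.
  have tb : t b = y by rewrite permM tpermL.
  have tA z : (t z \in A) = (z \in A).
    have tp c d e : c \in A -> d \in A -> (tperm c d e \in A) = (e \in A).
      by move=> cA' dA; case: tpermP => [->|->|//]; rewrite ?cA' ?dA.
    by rewrite permM !tp.
  rewrite -(avg_reindex (Z a b) (mulgI t)); apply: eq_avg => s /=.
  rewrite /Z (reindex_inj (@perm_inj _ t)) /=; apply: eq_big => z.
    by rewrite tA -ta -tb !(inj_eq perm_inj).
  by move=> _; rewrite -ta -tb /sgn /= !permM.
have -> : avg (fun s => \prod_(x in C) (sg s a x * sg s b x)) = avg (Z a b).
  apply: eq_avg => s; apply: eq_bigl => z; rewrite !inE.
  have [->|za] := eqVneq z a; first by rewrite (negPf aC).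
  by have [->|zb] := eqVneq z b; rewrite ?(negPf bC)//= andbT.
have S : \sum_(x in A) \sum_(y in A | y != x) avg (Z x y) = #|A|%:R.
  under eq_bigr do rewrite -avg_sum.
  rewrite -avg_sum -[RHS](avg_cst (perm_gt0 L)); apply: eq_avg => s.
  transitivity (\sum_(x in A) \sum_(y in A | y != x)
     - (rank_sign (u \o s) A x * rank_sign (u \o s) A y) : R).
    apply: eq_bigr => x xA; apply: eq_bigr => y /andP[yA yx].
    by rewrite ZE// eq_sym.
  transitivity (\sum_(x in A) (1 - rank_sign (u \o s) A x *
       \sum_(y in A) rank_sign (u \o s) A y) : R).
    apply: eq_bigr => x xA; rewrite sumrN -mulr_sumr [in RHS](bigD1 x)//=.
    suff : rank_sign (u \o s) A x * rank_sign (u \o s) A x = 1 :> R.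
      by rewrite mulrDr => ->; ring.
    by rewrite /rank_sign -big_split big1 //= => i _; rewrite sgn_sqr.
  rewrite (sum_rank_sign _ (@uperm_inj s)) cA /= negbK (negPf eC).
  by under eq_bigr do rewrite mulr0 subr0; rewrite sumr_const cA.
have : (#|C|%:R + 2) * ((#|C|%:R + 1) * avg (Z a b)) = #|C|%:R + 2.
  have -> : (#|C|%:R + 2 : R) = #|A|%:R by rewrite cA -[#|C|.+2]addn2 natrD.
  rewrite -[RHS]S.
  transitivity (\sum_(x in A) ((#|C|%:R + 1) * avg (Z a b))).
    by rewrite sumr_const mulr_natl.
  apply: eq_bigr => x xA.
  transitivity (\sum_(y in A | y != x) avg (Z a b)).
    rewrite sumr_const -[RHS]mulr_natl; congr (_ * _).
    have -> : #|[pred y in A | y != x]| = #|C|.+1.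
      have := cardsD1 x A; rewrite xA cA => -[->].
      by apply: eq_card => y; rewrite !inE andbC.
    by rewrite -[#|C|.+1]addn1 natrD.
  by apply: eq_bigr => y /andP[yA yx]; rewrite Zinv// eq_sym.
have c0 : (#|C|%:R + 2 : R) != 0 by rewrite -natrD pnatr_eq0 addn2.
rewrite -[RHS]mulr1 => /(mulfI c0) E.
have c1 : (#|C|%:R + 1 : R) != 0 by rewrite natr1 pnatr_eq0.
by apply: (mulfI c1); rewrite E mulfV.
Qed.
End SignMoments.

Section CrossingSigns.
Context {R : realType} {V : finType}.
Implicit Types (v : V * bool -> nat) (p q r t : V).

(** The labels (p, false) and (p, true) are the endpoints of the chord p.  The
    product is -1 when the chords p and q cross, that is when exactly one endpoint
    of q lies between those of p, and 1 otherwise. *)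
Definition crossing_sign v p q : R :=
  \prod_(b : bool) \prod_(c : bool) sgn v (p, b) (q, c).

Lemma crossing_signE v p q : crossing_sign v p q =
  sgn v (p, true) (q, true) * sgn v (p, true) (q, false) *
  (sgn v (p, false) (q, true) * sgn v (p, false) (q, false)).
Proof. by rewrite /crossing_sign !big_bool. Qed.

Lemma crossing_sign_sqr v p q : crossing_sign v p q * crossing_sign v p q = 1.
Proof.
rewrite crossing_signE.
transitivity (\prod_(b : bool) \prod_(c : bool)
   (sgn v (p, b) (q, c) * sgn v (p, b) (q, c)) : R); first by rewrite !big_bool /=; ring.
by rewrite big1// => b _; rewrite big1// => c _; exact: sgn_sqr.
Qed.

Lemma crossing_sign_sym v p q : injective v -> p != q ->
  crossing_sign v q p = crossing_sign v p q.
Proof.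
move=> vI pq; rewrite !crossing_signE.
have ne b c : (p, b) != (q, c) by apply: contra pq => /eqP[->].
by rewrite !(@sgn_antisym _ _ v (p, _) (q, _)) ?ne//; ring.
Qed.

Lemma crossing_sign_norm v p q : `|crossing_sign v p q| = 1.
Proof.
apply/eqP; rewrite -(@eqrXn2 _ 2)// expr1n.
by rewrite real_normK ?num_real// expr2 crossing_sign_sqr.
Qed.

Variable u : V * bool -> nat.
Hypothesis uI : injective u.
Implicit Types s : {perm V * bool}.
Local Notation y s := (crossing_sign (u \o s)).

(** For a fixed chord p cutting the circle in two arcs of lengths L and 1 - L,
    every other chord contributes the mean (1 - 2 L)^2, and the average of
    (1 - 2 L)^(2 k) is 1 / (2 k + 1).  Here the endpoints of the other chords form
    the set C that those of p separate. *)
Lemma avg_prod_crossing_sign p (Q : {set V}) : p \notin Q ->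
  avg (fun s => \prod_(q in Q) y s p q) = (2 * #|Q|%:R + 1)^-1.
Proof.
move=> pQ; pose C := [set x : V * bool | x.1 \in Q]%SET.
have cC : #|C| = (2 * #|Q|)%N.
  have -> : C = finset.setX Q [set: bool]%SET by apply/setP => x; rewrite !inE andbT.
  by rewrite cardsX cardsT card_bool mulnC.
have := @avg_separation R _ u uI (p, true) (p, false) C.
rewrite !inE pQ cC mul2n odd_double -mul2n natrM => <- //; last by rewrite xpair_eqE andbF.
apply: eq_avg => s.
transitivity (\prod_(q in Q) \prod_(c : bool)
   (sgn (u \o s) (p, true) (q, c) * sgn (u \o s) (p, false) (q, c)) : R).
  by apply: eq_bigr => q _; rewrite crossing_signE !big_bool /=; ring.
rewrite pair_big_dep /=; apply: eq_big => [[q c]|[q c] _] //=.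
by rewrite !inE andbT.
Qed.

Lemma avg_crossing_sign p q : p != q -> avg (fun s => y s p q) = 1 / 3 :> R.
Proof.
move=> pq; have := @avg_prod_crossing_sign p [set q]%SET.
rewrite !inE cards1 mulr1 => /(_ pq) E.
rewrite -(natrD _ 2 1) addn1 in E; rewrite div1r -E.
by apply: eq_avg => s; rewrite big_set1.
Qed.

Lemma avg_crossing_sign2 p q r : p != q -> p != r -> q != r ->
  avg (fun s => y s p q * y s p r) = 1 / 5 :> R.
Proof.
move=> pq pr qr; have := @avg_prod_crossing_sign p [set q; r]%SET.
rewrite !inE cards2 qr negb_or pq pr => /(_ isT) E.
have {}E : avg (fun s => \prod_(q0 in [set q; r]%SET) y s p q0) = 5^-1 :> R.
  by rewrite E /= -natrM natr1.
rewrite div1r -E; apply: eq_avg => s.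
by rewrite big_setU1 ?inE//= big_set1.
Qed.

Definition labels (P : {set V}) : {set V * bool} := [set x | x.1 \in P]%SET.

Lemma sgn_same_order (P : {set V}) s s' x z : same_order u (labels P) s s' ->
  x.1 \in P -> z.1 \in P -> sgn (u \o s) x z = sgn (u \o s') x z :> R.
Proof. by move=> H xP zP; rewrite /sgn /= H ?inE. Qed.

Lemma crossing_sign_same_order (P : {set V}) s s' p q : same_order u (labels P) s s' ->
  p \in P -> q \in P -> y s p q = y s' p q :> R.
Proof.
move=> H pP qP; apply: eq_bigr => b _; apply: eq_bigr => c _.
exact: (sgn_same_order H).
Qed.

Lemma labels_disjoint (P Q : {set V}) : P :&: Q = finset.set0 ->
  {in labels P, forall x, x \notin labels Q}.
Proof.
move=> PQ x; rewrite !inE => xP; apply/negP => xQ.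
by have : x.1 \in P :&: Q; [rewrite inE xP|rewrite PQ inE].
Qed.

Lemma avg_crossing_sign_disjoint p q r t : p != q -> r != t ->
  p != r -> p != t -> q != r -> q != t ->
  avg (fun s => y s p q * y s r t) = 1 / 9 :> R.
Proof.
move=> pq rt pr pt qr qt.
rewrite (@avg_independent _ _ u uI (labels [set p; q]%SET) (labels [set r; t]%SET)).
- by rewrite !avg_crossing_sign//; field.
- apply: labels_disjoint; apply/setP => x; rewrite !inE; apply/negP.
  by case/andP => /orP[]/eqP->; rewrite ?(negPf pr) ?(negPf pt) ?(negPf qr) ?(negPf qt).
- by move=> s s' H; apply: (crossing_sign_same_order H); rewrite !inE eqxx ?orbT.
- by move=> s s' H; apply: (crossing_sign_same_order H); rewrite !inE eqxx ?orbT.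
Qed.

Lemma covariance_crossing_sign p q r t : p != q -> r != t ->
  avg (fun s => (y s p q - 1 / 3) * (y s r t - 1 / 3)) =
  4 / 45 * ((p == r)%:R + (p == t)%:R + (q == r)%:R + (q == t)%:R) +
  32 / 45 * ((p == r)%:R * (q == t)%:R + (p == t)%:R * (q == r)%:R) :> R.
Proof.
move=> pq rt.
have sym s a b : a != b -> y s b a = y s a b :> R.
  by move=> ab; apply: crossing_sign_sym => //; exact: uperm_inj.
have -> : avg (fun s => (y s p q - 1 / 3) * (y s r t - 1 / 3)) =
   avg (fun s => y s p q * y s r t) - 1 / 9 :> R.
  transitivity (avg (fun s => y s p q * y s r t + ((- (1 / 3)) * y s p q +
      ((- (1 / 3)) * y s r t + 1 / 9))) : R).
    by apply: eq_avg => s; field.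
  rewrite !avgD !avgZ (avg_cst (perm_gt0 _)) !avg_crossing_sign//.
  by field.
have [pr|pr] := eqVneq p r.
  subst r; have [qt|qt] := eqVneq q t.
    subst t; rewrite [q == p]eq_sym (negPf pq).
    under eq_avg do rewrite crossing_sign_sqr.
    by rewrite (avg_cst (perm_gt0 _)); rewrite ?eqxx /=; field.
  rewrite [q == p]eq_sym (negPf pq) (negPf rt).
  by rewrite avg_crossing_sign2//; rewrite ?eqxx /=; field.
have [pt|pt] := eqVneq p t.
  subst t; have [qr|qr] := eqVneq q r.
    subst r; rewrite (negPf rt).
    under eq_avg do rewrite (sym _ _ _ pq) crossing_sign_sqr.
    by rewrite (avg_cst (perm_gt0 _)); rewrite ?eqxx /=; field.
  rewrite [q == p]eq_sym (negPf pq).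
  under eq_avg do rewrite (sym _ _ _ pr).
  by rewrite avg_crossing_sign2//; rewrite ?eqxx /=; field.
have [qr|qr] := eqVneq q r.
  subst r; rewrite (negPf rt).
  under eq_avg do rewrite -(sym _ _ _ pq).
  by rewrite avg_crossing_sign2// 1?eq_sym//; rewrite ?eqxx /=; field.
have [qt|qt] := eqVneq q t.
  subst t; under eq_avg do rewrite -(sym _ _ _ pq) -(sym _ _ _ rt).
  by rewrite avg_crossing_sign2// 1?eq_sym//; rewrite ?eqxx /=; field.
by rewrite avg_crossing_sign_disjoint//; rewrite ?eqxx /=; field.
Qed.

End CrossingSigns.

(** * Variances of sums over chords *)

Lemma sum_delta (R : realType) (I : finType) (f : I -> R) (i : I) :
  \sum_j f j * (i == j)%:R = f i.
Proof.
rewrite (bigD1 i)//= eqxx mulr1 big1 ?addr0// => j ji.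
by rewrite eq_sym (negPf ji) mulr0.
Qed.

Section Variances.
Context {R : realType} {V : finType}.
Variable u : V * bool -> nat.
Hypothesis uI : injective u.
Implicit Types s : {perm V * bool}.
Local Notation y s := (@crossing_sign R V (u \o s)).

(** The first sum is the variance of the linear projections on the chords, the
    second one that of the degenerate part of the statistic. *)
Lemma variance_crossing_form (w : V -> V -> R) :
  (forall p, w p p = 0) -> (forall p q, w p q = w q p) ->
  avg (fun s => (\sum_p \sum_q w p q * (y s p q - 1 / 3)) ^+ 2) =
  16 / 45 * \sum_p (\sum_q w p q) ^+ 2 + 64 / 45 * \sum_p \sum_q w p q ^+ 2.
Proof.
move=> w0 wS; pose z p q s := y s p q - 1 / 3; pose rho p := \sum_q w p q.
have cov p q r t : avg (fun s => (w p q * z p q s) * (w r t * z r t s)) =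
   w p q * (w r t * (4 / 45 * ((p == r)%:R + (p == t)%:R + (q == r)%:R + (q == t)%:R) +
  32 / 45 * ((p == r)%:R * (q == t)%:R + (p == t)%:R * (q == r)%:R))).
  transitivity (avg (fun s => (w p q * w r t) * (z p q s * z r t s))).
    by apply: eq_avg => s; ring.
  rewrite avgZ -mulrA.
  have [->|pq] := eqVneq p q; first by rewrite w0 !mul0r.
  have [->|rt] := eqVneq r t; first by rewrite w0 !mul0r.
  by rewrite covariance_crossing_sign.
have d1 p q : \sum_r \sum_t w r t *
    (4 / 45 * ((p == r)%:R + (p == t)%:R + (q == r)%:R + (q == t)%:R) +
  32 / 45 * ((p == r)%:R * (q == t)%:R + (p == t)%:R * (q == r)%:R)) =
  8 / 45 * (rho p + rho q) + 64 / 45 * w p q.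
  transitivity (\sum_r (4 / 45 * (rho r * (p == r)%:R + w r p + rho r * (q == r)%:R + w r q)
     + 32 / 45 * (w r q * (p == r)%:R + w r p * (q == r)%:R))).
    apply: eq_bigr => r _.
    under eq_bigr do rewrite mulrDr [w r _ * (4 / 45 * _)]mulrCA [w r _ * (32 / 45 * _)]mulrCA.
    rewrite big_split /= -!mulr_sumr; congr (_ * _ + _ * _).
      under eq_bigr do rewrite !mulrDr.
      by rewrite !big_split /= -!mulr_suml !sum_delta.
    under eq_bigr do rewrite !mulrDr mulrA [w r _ * (_ * _)]mulrA.
    rewrite !big_split /= -mulr_suml sum_delta; congr (_ + _).
    by rewrite sum_delta.
  rewrite big_split /= -!mulr_sumr !big_split /= !sum_delta.
  have E x : \sum_r w r x = rho x by apply: eq_bigr => r _.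
  by rewrite !E (wS q p); field.
transitivity (avg (fun s => \sum_p \sum_q \sum_r \sum_t
   (w p q * z p q s) * (w r t * z r t s))).
  apply: eq_avg => s; rewrite expr2 mulr_suml; apply: eq_bigr => p _.
  rewrite mulr_suml; apply: eq_bigr => q _.
  rewrite mulr_sumr; apply: eq_bigr => r _.
  by rewrite mulr_sumr.
rewrite avg_sum.
transitivity (\sum_p \sum_q w p q * (8 / 45 * (rho p + rho q) + 64 / 45 * w p q)).
  apply: eq_bigr => p _; rewrite avg_sum; apply: eq_bigr => q _.
  rewrite avg_sum -d1 mulr_sumr; apply: eq_bigr => r _.
  rewrite avg_sum mulr_sumr; apply: eq_bigr => t _.
  by rewrite cov.
transitivity (\sum_p (8 / 45 * (rho p * rho p) + 8 / 45 * (\sum_q w q p * rho q)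
    + 64 / 45 * \sum_q w p q ^+ 2)).
  apply: eq_bigr => p _; rewrite !mulr_suml !mulr_sumr -!big_split /=.
  by apply: eq_bigr => q _; rewrite (wS q p); ring.
rewrite !big_split /= -!mulr_sumr exchange_big /=; congr (_ + _).
have -> : \sum_i \sum_j w i j * rho i = \sum_i rho i * rho i.
  by apply: eq_bigr => i _; rewrite -mulr_suml.
by field.
Qed.

(** Only the pairs of terms that share a chord contribute to the variance, each by
    at most 2; through its at most k chords, a term meets at most k N terms. *)
Lemma variance_local_dependence (I : finType) (Y : I -> {perm V * bool} -> R)
    (S : I -> {set V}) (k N : nat) :
  (forall i s, `|Y i s| <= 1) ->
  (forall i, depends_on u (labels (S i)) (Y i)) ->
  (forall i, (#|S i| <= k)%N) ->
  (forall v, (\sum_i (v \in S i) <= N)%N) ->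
  avg (fun s => (\sum_i Y i s - avg (fun s => \sum_i Y i s)) ^+ 2) <=
  2 * (#|I| * (k * N))%:R.
Proof.
move=> Y1 YS Sk SN.
pose Z i s := Y i s - avg (Y i).
have a0 := avg_cst (perm_gt0 (V * bool)%type).
have covE i j : avg (fun s => Z i s * Z j s) =
    avg (fun s => Y i s * Y j s) - avg (Y i) * avg (Y j).
  transitivity (avg (fun s => Y i s * Y j s + ((- avg (Y j)) * Y i s +
      ((- avg (Y i)) * Y j s + avg (Y i) * avg (Y j))))).
    by apply: eq_avg => s; rewrite /Z; ring.
  by rewrite !avgD a0 !avgZ; ring.
have absY i : `|avg (Y i)| <= 1.
  apply: le_trans (avg_norm _) _; rewrite -[leRHS](a0 R); exact: le_avg.
have cov_le i j : avg (fun s => Z i s * Z j s) <= 2 * (\sum_(v in S i) (v \in S j))%:R.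
  rewrite covE; have [d|nd] := boolP (S i :&: S j == finset.set0).
    rewrite (@avg_independent _ _ u uI (labels (S i)) (labels (S j))) ?subrr ?mulr_ge0//.
    exact/labels_disjoint/eqP.
  have H1 : avg (fun s => Y i s * Y j s) <= 1.
    rewrite -[leRHS](a0 R); apply: le_avg => s; apply: le_trans (ler_norm _) _.
    by rewrite normrM mulr_ile1.
  have H2 : - (avg (Y i) * avg (Y j)) <= 1.
    by apply: le_trans (ler_norm _) _; rewrite normrN normrM mulr_ile1.
  have [v] := set0Pn _ nd; rewrite inE => /andP[vi vj].
  have : 1 <= (\sum_(v in S i) (v \in S j))%:R :> R.
    by rewrite ler1n (bigD1 v)//= vj.
  lra.
have -> : avg (fun s => (\sum_i Y i s - avg (fun s => \sum_i Y i s)) ^+ 2) =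
    \sum_i \sum_j avg (fun s => Z i s * Z j s).
  rewrite avg_sum.
  under [RHS]eq_bigr do rewrite -avg_sum.
  rewrite -[RHS]avg_sum; apply: eq_avg => s.
  rewrite -sumrB expr2 mulr_suml; apply: eq_bigr => i _.
  by rewrite mulr_sumr.
apply: (@le_trans _ _ (\sum_(i : I) 2 * (k * N)%:R)); last first.
  by rewrite sumr_const -[leLHS]mulr_natl [in leRHS]natrM mulrCA.
apply: ler_sum => i _.
apply: (@le_trans _ _ (2 * (\sum_j \sum_(v in S i) (v \in S j))%:R)).
  by rewrite natr_sum mulr_sumr; apply: ler_sum => j _; exact: cov_le.
rewrite ler_wpM2l// ler_nat exchange_big /=.
apply: (@leq_trans (\sum_(v in S i) N)); first by apply: leq_sum => v _; exact: SN.
by rewrite sum_nat_const leq_mul2r Sk orbT.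
Qed.

End Variances.

(** * The number of crossings of a random chord diagram *)

(** The number of crossings of n chords minus n (n - 1) / 6: each of the ordered
    pairs of distinct chords accounts for (1 - sign) / 4. *)
Definition centered_crossings (R : realType) (n : nat) (v : 'I_n * bool -> nat) : R :=
  - (1 / 4) * \sum_i \sum_(j | j != i) (crossing_sign v i j - 1 / 3).

Lemma eq_centered_crossings (R : realType) (n : nat) (v w : 'I_n * bool -> nat) :
  (forall a b, (v a < v b)%N = (w a < w b)%N) ->
  centered_crossings R v = centered_crossings R w.
Proof.
move=> vw; congr (_ * _); apply: eq_bigr => i _; apply: eq_bigr => j _.
congr (_ - _); apply: eq_bigr => b _; apply: eq_bigr => c _.
by rewrite /sgn vw.
Qed.

Lemma sum_offdiag (R : realType) (n : nat) (F : 'I_n -> 'I_n -> R) (i : 'I_n) :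
  (forall a b, a != b -> F a b = F b a) ->
  \sum_a \sum_(b | b != a) F a b = 2 * \sum_(b | b != i) F i b +
    \sum_(a | a != i) \sum_(b | (b != a) && (b != i)) F a b.
Proof.
move=> FS; rewrite (bigD1 i)//= mulr_natl mulr2n -addrA; congr (_ + _).
rewrite -big_split /=; apply: eq_bigr => a ai.
rewrite (bigD1 i)/=; last by rewrite eq_sym.
by rewrite FS.
Qed.

Lemma sum_other (R : realType) (n : nat) (i : 'I_n) :
  \sum_(j | j != i) 1 = n%:R - 1 :> R.
Proof.
rewrite sumr_const cardC1 card_ord.
by case: n i => [[]//|n] i; rewrite -natr1 addrK.
Qed.

Section CrossingVariance.
Context {R : realType} (n : nat).
Variable u : 'I_n * bool -> nat.
Hypothesis uI : injective u.

Lemma avg_centered_crossings :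
  avg (fun s : {perm 'I_n * bool} => centered_crossings R (u \o s)) = 0.
Proof.
rewrite avgZ avg_sum big1 ?mulr0// => i _; rewrite avg_sum big1// => j ji.
rewrite avgB (avg_cst (perm_gt0 _)) (avg_crossing_sign uI) ?subrr//.
by rewrite eq_sym.
Qed.

Lemma variance_crossings : (0 < n)%N ->
  avg (fun s : {perm 'I_n * bool} => centered_crossings R (u \o s) ^+ 2) =
  n%:R * (n%:R - 1) * (n%:R + 3) / 45.
Proof.
move=> n0; pose w (i j : 'I_n) : R := if j != i then - (1 / 4) else 0.
have row i : \sum_j w i j = - (1 / 4) * (n%:R - 1).
  rewrite -(sum_other R i) mulr_sumr /w -big_mkcond /=.
  by apply: eq_bigr => j _; rewrite mulr1.
transitivity (avg (fun s : {perm 'I_n * bool} =>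
   (\sum_i \sum_j w i j * (crossing_sign (u \o s) i j - 1 / 3)) ^+ 2)).
  apply: eq_avg => s; congr (_ ^+ 2); rewrite /centered_crossings mulr_sumr; apply: eq_bigr => i _.
  rewrite mulr_sumr big_mkcond /=; apply: eq_bigr => j _.
  by rewrite /w; case: ifP => _; rewrite ?mul0r.
rewrite variance_crossing_form//; first last.
- by move=> p q; rewrite /w eq_sym.
- by move=> p; rewrite /w eqxx.
have -> : \sum_p (\sum_q w p q) ^+ 2 = n%:R * (1 / 16 * (n%:R - 1) ^+ 2).
  under eq_bigr do rewrite row.
  by rewrite sumr_const card_ord -[LHS]mulr_natl; field.
have -> : \sum_p \sum_q w p q ^+ 2 = n%:R * (1 / 16 * (n%:R - 1)).
  transitivity (\sum_(p : 'I_n) (- (1 / 4) * (- (1 / 4) * (n%:R - 1)) : R)).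
    apply: eq_bigr => p _; rewrite -(row p) mulr_sumr; apply: eq_bigr => q _.
    by rewrite /w; case: ifP => _; rewrite ?expr2 ?mulr0.
  by rewrite sumr_const card_ord -[LHS]mulr_natl; field.
by field.
Qed.

End CrossingVariance.

Section SwapChords.
Context {V : finType}.

Let swap_fun (p q : V) (x : V * bool) := (tperm p q x.1, x.2).

Let swap_funI p q : injective (swap_fun p q).
Proof. by move=> [a b] [c d] [/perm_inj -> ->]. Qed.

Definition swap_chords p q : {perm V * bool} := perm (@swap_funI p q).

Lemma swap_chordsE p q a b : swap_chords p q (a, b) = (tperm p q a, b).
Proof. by rewrite permE. Qed.

Lemma swap_chordsK p q : (swap_chords p q * swap_chords p q = 1)%g.
Proof. by apply/permP => -[a b]; rewrite permM !swap_chordsE tpermK perm1. Qed.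

Lemma crossing_sign_swap (R : realType) (u : V * bool -> nat) p q s a b :
  crossing_sign (u \o (swap_chords p q * s)%g) a b =
  crossing_sign (u \o s) (tperm p q a) (tperm p q b) :> R.
Proof.
apply: eq_bigr => c _; apply: eq_bigr => e _.
by rewrite /sgn /= !permM !swap_chordsE.
Qed.

End SwapChords.

Section ExchangeChord.
Context {R : realType} (n m : nat).
Local Notation V := ('I_n + 'I_m)%type.
Variable u : V * bool -> nat.
Hypothesis uI : injective u.
Implicit Types s : {perm V * bool}.
Local Notation y s := (@crossing_sign R V (u \o s)).
Local Notation z s p q := (y s p q - 1 / 3).

Definition diagram s (x : 'I_n * bool) : nat := u (s (inl x.1, x.2)).

(** The chord i of the diagram becomes the fresh chord r and conversely.  Averaging
    over many fresh chords replaces the conditional expectation given the diagram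
    of the effect of a new independent chord. *)
Definition exchange (ir : 'I_n * 'I_m) s := (swap_chords (inl ir.1) (inr ir.2) * s)%g.

Local Notation X s := (centered_crossings R (diagram s)).

Lemma exchangeK ir : involutive (exchange ir).
Proof. by move=> s; rewrite /exchange mulgA swap_chordsK mul1g. Qed.

Lemma diagram_crossingsE s : X s =
  - (1 / 4) * \sum_i \sum_(j | j != i) z s (inl i) (inl j).
Proof. by []. Qed.

Lemma exchange_increment i r s : X (exchange (i, r) s) - X s =
  1 / 2 * \sum_(j | j != i) (y s (inl i) (inl j) - y s (inr r) (inl j)).
Proof.
have sym (t : {perm V * bool}) p q : p != q -> y t p q = y t q p.
  by move=> pq; apply/esym/crossing_sign_sym => //; exact: (uperm_inj uI).
have zS (t : {perm V * bool}) (a b : 'I_n) : a != b -> z t (inl a) (inl b) = z t (inl b) (inl a).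
  by move=> ab; rewrite sym.
rewrite !diagram_crossingsE !(sum_offdiag i)//=; try exact: zS.
have -> : \sum_(a | a != i) \sum_(b | (b != a) && (b != i)) z (exchange (i, r) s) (inl a) (inl b)
   = \sum_(a | a != i) \sum_(b | (b != a) && (b != i)) z s (inl a) (inl b).
  apply: eq_bigr => a ai; apply: eq_bigr => b /andP[ba bi].
  by rewrite crossing_sign_swap /= !tpermD// eq_sym.
have -> : \sum_(b | b != i) z (exchange (i, r) s) (inl i) (inl b) =
   \sum_(b | b != i) z s (inr r) (inl b).
  by apply: eq_bigr => b bi; rewrite crossing_sign_swap /= tpermL tpermD// eq_sym.
by rewrite !sumrB; field.
Qed.

Lemma exchange_increment_norm i r s : `|X (exchange (i, r) s) - X s| <= n%:R - 1.
Proof.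
rewrite exchange_increment normrM ger0_norm ?divr_ge0//.
have : `|\sum_(j | j != i) (y s (inl i) (inl j) - y s (inr r) (inl j))| <=
    \sum_(j | j != i) 2.
  apply: le_trans (ler_norm_sum _ _ _) _; apply: ler_sum => j _.
  by apply: le_trans (ler_normB _ _) _; rewrite !crossing_sign_norm -mulr2n.
have -> : \sum_(j | j != i) 2 = 2 * (n%:R - 1) :> R.
  by rewrite -(sum_other R i) mulr_sumr; apply: eq_bigr => j _; rewrite mulr1.
lra.
Qed.

End ExchangeChord.

Lemma sum_pair (R : realType) (I J : finType) (F : I * J -> R) :
  \sum_x F x = \sum_i \sum_j F (i, j).
Proof. by rewrite pair_big_dep; apply: eq_bigr => -[]. Qed.

Section ExchangeableChords.
Context {R : realType} (n m : nat).
Local Notation V := ('I_n + 'I_m)%type.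
Variable u : V * bool -> nat.
Hypothesis uI : injective u.
Implicit Types s : {perm V * bool}.
Local Notation y s := (@crossing_sign R V (u \o s)).
Local Notation z s p q := (y s p q - 1 / 3).
Local Notation CX s := (centered_crossings R (diagram u s)).

Definition drift s : R := CX s + m%:R^-1 * \sum_ir (CX (exchange ir s) - CX s).

(** In the drift the linear projections of the crossings on the chords of the
    diagram cancel: what remains is the degenerate part of the statistic and the
    fluctuation, of order n^2 / sqrt m, of the average over the fresh chords. *)
Lemma driftE s : (0 < m)%N -> drift s =
  1 / 4 * \sum_i \sum_(j | j != i) z s (inl i) (inl j) -
  (n%:R - 1) / (2 * m%:R) * \sum_r \sum_j z s (inr r) (inl j).
Proof.
move=> m0; have m1 : m%:R != 0 :> R by rewrite pnatr_eq0 -lt0n.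
rewrite /drift diagram_crossingsE sum_pair.
have -> : \sum_i \sum_r (CX (exchange (i, r) s) - CX s) =
    1 / 2 * (m%:R * (\sum_i \sum_(j | j != i) z s (inl i) (inl j)) -
             (n%:R - 1) * \sum_r \sum_j z s (inr r) (inl j)).
  transitivity (\sum_i \sum_r (1 / 2 * (\sum_(j | j != i) z s (inl i) (inl j))
      - 1 / 2 * \sum_(j | j != i) z s (inr r) (inl j))).
    apply: eq_bigr => i _; apply: eq_bigr => r _; rewrite exchange_increment//.
    by rewrite -mulrBr -sumrB; congr (_ * _); apply: eq_bigr => j _; ring.
  under eq_bigr do rewrite sumrB -!mulr_sumr sumr_const card_ord -[X in _ * X - _]mulr_natl.
  rewrite sumrB -!mulr_sumr mulrBr; congr (_ * _ - _ * _).
  rewrite exchange_big mulr_sumr /=; apply: eq_bigr => r _.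
  rewrite (exchange_big_dep xpredT)//= mulr_sumr; apply: eq_bigr => j _.
  rewrite -(sum_other R j) mulr_suml; apply: eq_big => [i|i _]; first by rewrite eq_sym.
  by rewrite [RHS]mul1r.
by field.
Qed.

Lemma drift_second_moment : (0 < n)%N -> (0 < m)%N ->
  avg (fun s => drift s ^+ 2) =
  n%:R * (n%:R - 1) / 45 * (n%:R * (n%:R - 1) / m%:R + 4 + 8 * (n%:R - 1) / m%:R).
Proof.
move=> n0 m0; have m1 : m%:R != 0 :> R by rewrite pnatr_eq0 -lt0n.
(* A diagram chord and a fresh one form two ordered pairs, which share the
   coefficient - (n - 1) / (2 m) of their sign in the drift. *)
pose c : R := - (n%:R - 1) / (4 * m%:R).
pose w (p q : V) : R := match p, q with
  | inl i, inl j => if j != i then 1 / 4 else 0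
  | inr _, inr _ => 0
  | _, _ => c
  end.
have wsum (a : R) i : \sum_j (if j != i :> 'I_n then a else 0) = (n%:R - 1) * a.
  rewrite -big_mkcond /= -(sum_other R i) mulr_suml.
  by apply: eq_bigr => j _; rewrite mul1r.
have wcst k (a : R) : \sum_(j : 'I_k) a = k%:R * a.
  by rewrite sumr_const card_ord -[LHS]mulr_natl.
transitivity (avg (fun s => (\sum_p \sum_q w p q * z s p q) ^+ 2)).
  apply: eq_avg => s; congr (_ ^+ 2); rewrite driftE//.
  have -> : \sum_p \sum_q w p q * z s p q =
      \sum_i \sum_j (if j != i then 1 / 4 else 0) * z s (inl i) (inl j) +
      (\sum_i \sum_r c * z s (inl i) (inr r) + \sum_r \sum_j c * z s (inr r) (inl j)).
    rewrite big_sumType addrA -big_split /=; congr (_ + _); apply: eq_bigr => i _.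
      by rewrite big_sumType.
    by rewrite big_sumType /= [X in _ + X]big1 ?addr0// => j _; rewrite mul0r.
  congr (_ + _).
    rewrite mulr_sumr; apply: eq_bigr => i _; rewrite mulr_sumr big_mkcond /=.
    by apply: eq_bigr => j _; case: ifP; rewrite ?mul0r.
  rewrite [X in _ = X + _]exchange_big /= -big_split mulr_sumr -sumrN /=.
  apply: eq_bigr => r _; rewrite mulr_sumr -sumrN -big_split /=.
  apply: eq_bigr => j _.
  by rewrite (@crossing_sign_sym _ _ _ (inr r))//; [rewrite /c; field|exact: uperm_inj].
rewrite variance_crossing_form//; first last.
- by move=> [i|r] [j|t] //=; rewrite eq_sym.
- by move=> [i|r] //=; rewrite eqxx.
have -> : \sum_p (\sum_q w p q) ^+ 2 =
    \sum_(i < n) ((n%:R - 1) * (1 / 4) + m%:R * c) ^+ 2 + \sum_(r < m) (n%:R * c) ^+ 2.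
  rewrite big_sumType /=; congr (_ + _); apply: eq_bigr => i _.
    by rewrite big_sumType /= wsum wcst.
  by rewrite big_sumType /= wcst [X in _ + X]big1 ?addr0.
have -> : \sum_p \sum_q w p q ^+ 2 =
    \sum_(i < n) ((n%:R - 1) * (1 / 4) ^+ 2 + m%:R * c ^+ 2) + \sum_(r < m) (n%:R * c ^+ 2).
  rewrite big_sumType /=; congr (_ + _); apply: eq_bigr => i _.
    rewrite big_sumType /= wcst -(wsum _ i); congr (_ + _).
    by apply: eq_bigr => j _; case: ifP => // _; rewrite expr0n.
  by rewrite big_sumType /= wcst [X in _ + X]big1 ?addr0// => j _; rewrite expr0n.
by rewrite !wcst /c; field.
Qed.

Lemma diagram_variance : (0 < n)%N ->
  avg (fun s => CX s ^+ 2) = n%:R * (n%:R - 1) * (n%:R + 3) / 45.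
Proof.
move=> n0; pose v (x : 'I_n * bool) : nat := enum_rank x.
have vI : injective v by move=> a b /val_inj /enum_rank_inj.
pose e (x : 'I_n * bool) : V * bool := (inl x.1, x.2).
rewrite -(variance_crossings vI n0).
apply: (@avg_restrict R _ _ v u e (fun v => centered_crossings R v ^+ 2)) => //.
  by move=> [a b] [c d] [-> ->].
by move=> v1 v2 H; rewrite (eq_centered_crossings R H).
Qed.

Definition squared_increments s : R := \sum_ir (CX (exchange ir s) - CX s) ^+ 2.

(** The sum of the squared increments is a sum of n^3 m terms of which each
    involves at most four chords. *)
Lemma variance_squared_increments : (n <= m)%N ->
  avg (fun s => (squared_increments s - avg squared_increments) ^+ 2) <= 24 * n%:R ^+ 5 * m%:R ^+ 2.
Proof.
move=> nm; pose Q := squared_increments.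
pose d s i r j := 1 / 2 * (y s (inl i) (inl j) - y s (inr r) (inl j)).
pose Y (a : 'I_n * 'I_m * ('I_n * 'I_n)) s : R :=
  ((a.2.1 != a.1.1) && (a.2.2 != a.1.1))%:R *
  (d s a.1.1 a.1.2 a.2.1 * d s a.1.1 a.1.2 a.2.2).
pose S (a : 'I_n * 'I_m * ('I_n * 'I_n)) : {set V} :=
  [set inl a.1.1; inr a.1.2; inl a.2.1; inl a.2.2]%SET.
have QE s : Q s = \sum_a Y a s.
  rewrite /Q /squared_increments sum_pair [RHS]sum_pair sum_pair; apply: eq_bigr => i _; apply: eq_bigr => r _.
  rewrite sum_pair exchange_increment// mulr_sumr expr2 mulr_suml.
  rewrite big_mkcond; apply: eq_bigr => j _ /=.
  case: ifP => ji; last first.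
    by rewrite big1// => k _; rewrite /Y /= ji mul0r.
  rewrite mulr_sumr big_mkcond; apply: eq_bigr => k _.
  by rewrite /Y /= ji; case: ifP => ki; rewrite ?[RHS]mul1r ?[RHS]mul0r.
have d1 s i r j : `|d s i r j| <= 1.
  rewrite normrM ger0_norm ?divr_ge0//.
  have := ler_normB (y s (inl i) (inl j)) (y s (inr r) (inl j)).
  by rewrite !crossing_sign_norm; lra.
(* A diagram chord occurs as i, j or k, each time in m n^2 terms; a fresh chord
   occurs as r, in n^3 <= m n^2 terms. *)
have := @variance_local_dependence R V u uI _ Y S 4 (3 * (m * (n * n))).
rewrite !card_prod !card_ord.
have -> : avg (fun s => (\sum_i Y i s - avg (fun s => \sum_i Y i s)) ^+ 2) =
   avg (fun s => (Q s - avg Q) ^+ 2).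
  by apply: eq_avg => s; rewrite -QE; congr ((_ - _) ^+ 2); apply: eq_avg => t; rewrite QE.
move=> H; apply: le_trans (H _ _ _ _) _.
- move=> a s; rewrite /Y; move: (d1 s a.1.1 a.1.2 a.2.1) (d1 s a.1.1 a.1.2 a.2.2).
  move: (d s a.1.1 a.1.2 a.2.1) (d s a.1.1 a.1.2 a.2.2) => p q p1 q1.
  by rewrite !normrM !mulr_ile1//; case: (_ && _); rewrite ?normr1 ?normr0.
- move=> [[i r] [j k]] s t st; rewrite /Y /=; congr (_ * _).
  by rewrite /d !(crossing_sign_same_order st) ?inE ?eqxx ?orbT.
- move=> a; have h (A : {set V}) x : (#|A :|: [set x]%SET| <= #|A|.+1)%N.
    by rewrite (leq_trans (leq_card_setU _ _))// cards1 addn1.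
  do 2!(apply: leq_trans (h _ _) _; rewrite ltnS).
  by rewrite cards2; case: (_ != _).
- have cnt1 (A B : finType) (F : A -> nat) :
      (\sum_(x : A * B) F x.1 = (\sum_a F a) * #|B|)%N.
    rewrite -(pair_bigA _ (fun a _ => F a)) /= big_distrl; apply: eq_bigr => a _.
    by rewrite sum_nat_const mulnC.
  have cnt2 (A B : finType) (F : B -> nat) :
      (\sum_(x : A * B) F x.2 = #|A| * \sum_b F b)%N.
    by rewrite -(pair_bigA _ (fun _ b => F b)) /= sum_nat_const.
  have one (A : finType) (a : A) : (\sum_(b : A) (b == a) = 1)%N.
    by rewrite (bigD1 a)//= eqxx big1// => b /negPf ->.
  move=> [a|r].
    apply: (@leq_trans (\sum_(x : 'I_n * 'I_m * ('I_n * 'I_n))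
        ((x.1.1 == a) + (x.2.1 == a) + (x.2.2 == a)))%N).
      apply: leq_sum => x _; rewrite !inE.
      have eL (i j : 'I_n) : (inl i == inl j :> V) = (j == i) by rewrite eq_sym.
      by rewrite !eL /=; do 3!case: (_ == a).
    rewrite !big_split /=.
    rewrite (cnt1 _ _ (fun y : 'I_n * 'I_m => (y.1 == a) : nat)).
    rewrite (cnt2 _ _ (fun y : 'I_n * 'I_n => (y.1 == a) : nat)).
    rewrite (cnt2 _ _ (fun y : 'I_n * 'I_n => (y.2 == a) : nat)).
    rewrite !(cnt1 _ _ (fun y => (y == a) : nat)) (cnt2 _ _ (fun y => (y == a) : nat)).
    by rewrite !one !card_prod !card_ord; nia.
  apply: (@leq_trans (\sum_(x : 'I_n * 'I_m * ('I_n * 'I_n)) (x.1.2 == r))%N).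
    apply: leq_sum => x _; rewrite !inE /= !orbF.
    have eR (i j : 'I_m) : (inr i == inr j :> V) = (j == i) by rewrite eq_sym.
    by rewrite eR.
  rewrite (cnt1 _ _ (fun y : 'I_n * 'I_m => (y.2 == r) : nat)).
  rewrite (cnt2 _ _ (fun y => (y == r) : nat)) one !card_prod !card_ord.
  by nia.
by rewrite le_eqVlt; apply/orP; left; apply/eqP; rewrite !natrM; ring.
Qed.

(** After division by sigma, and with m = n^2 fresh chords, the drift is at most
    3 / sqrt n in L^2, the increments are at most 7 / sqrt n, and the quadratic
    variation K is at most 49 / 2 and within 111 / sqrt n of its mean in L^2.
    Stein's method then gives 921 / sqrt n. *)
Lemma kolmogorov_diagram x : (1 < n)%N -> m = (n * n)%N ->
  `|avg (fun s => (CX s / Num.sqrt (n%:R * (n%:R - 1) * (n%:R + 3) / 45) <= x)%R%:R)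
    - gauss_cdf x| <= 1868 / Num.sqrt n%:R.
Proof.
move=> n1 mE; have n0 : (0 < n)%N by lia.
have m0 : (0 < m)%N by rewrite mE muln_gt0 n0.
have nm : (n <= m)%N by rewrite mE leq_pmulr.
have ME : m%:R = n%:R ^+ 2 :> R by rewrite mE natrM expr2.
have N2 : 2 <= n%:R :> R by rewrite ler_nat.
pose q : R := Num.sqrt n%:R.
have qq : q ^+ 2 = n%:R by rewrite sqr_sqrtr.
have q0 : 0 < q by rewrite sqrtr_gt0; lra.
have q1 : 1 <= q by rewrite -(@ler_pXn2r _ 2)// ?nnegrE ?(ltW q0)// expr1n qq; lra.
pose S2 : R := n%:R * (n%:R - 1) * (n%:R + 3) / 45; pose sigma := Num.sqrt S2.
have S2_ge : n%:R ^+ 3 / 45 <= S2.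
  rewrite /S2 ler_wpM2r//; move: (n%:R : R) N2 => N N2.
  rewrite exprSr expr2 -!mulrA; nra.
have S20 : 0 < S2.
  by apply: lt_le_trans S2_ge; rewrite divr_gt0// exprn_gt0//; lra.
have ss : sigma ^+ 2 = S2 by rewrite sqr_sqrtr// ltW.
have s0 : 0 < sigma by rewrite sqrtr_gt0.
pose W s := CX s / sigma; pose T s := drift s / sigma.
have WT : forall s, m%:R^-1 * \sum_ir (W (exchange ir s) - W s) = T s - W s.
  move=> s; rewrite /T /W /drift [in RHS]mulrDl [RHS]addrC addKr -[RHS]mulrA [in RHS]mulr_suml.
  by congr (_ * _); apply: eq_bigr => ir _; rewrite mulrBl.
have D_le ir s : `|W (exchange ir s) - W s| <= 7 / q.
  case: ir => i r; rewrite /W -mulrBl normrM [X in _ * X]gtr0_norm ?invr_gt0//.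
  rewrite ler_pdivrMr// mulrAC ler_pdivlMr//.
  apply: (@le_trans _ _ ((n%:R - 1) * q)).
    by rewrite ler_wpM2r ?(ltW q0)// exchange_increment_norm.
  rewrite -(@ler_pXn2r _ 2)// ?nnegrE ?mulr_ge0 ?(ltW q0) ?(ltW s0)//; last by lra.
  rewrite !exprMn qq ss /S2; move: (n%:R : R) N2 => N N2.
  rewrite -subr_ge0.
  have -> : 7 ^+ 2 * (N * (N - 1) * (N + 3) / 45) - (N - 1) ^+ 2 * N =
    N * (N - 1) * ((49 * (N + 3) - 45 * (N - 1)) / 45) by field.
  by rewrite !mulr_ge0 ?divr_ge0//; lra.
have c0 : 0 <= m%:R^-1 :> R by rewrite invr_ge0.
have M0 : m%:R != 0 :> R by rewrite pnatr_eq0 -lt0n.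
have O0 := perm_gt0 (V * bool)%type.
pose K := quadratic_variation (@exchange n m) W (m%:R^-1).
have W2 : avg (fun s => W s ^+ 2) = 1.
  transitivity (S2^-1 * avg (fun s => CX s ^+ 2)).
    by rewrite -avgZ; apply: eq_avg => s; rewrite exprMn exprVn ss mulrC.
  by rewrite diagram_variance// mulVf// gt_eqF.
have T2 : avg (fun s => T s ^+ 2) <= (3 / q) ^+ 2.
  have -> : avg (fun s => T s ^+ 2) = S2^-1 * avg (fun s => drift s ^+ 2).
    by rewrite -avgZ; apply: eq_avg => s; rewrite exprMn exprVn ss mulrC.
  rewrite drift_second_moment// mulrC ler_pdivrMr// exprMn exprVn qq ME /S2.
  move: (n%:R : R) N2 => N N2.
  have N0 : N != 0 by rewrite gt_eqF//; lra.
  rewrite -subr_ge0.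
  have -> : 3 ^+ 2 / N * (N * (N - 1) * (N + 3) / 45) -
     N * (N - 1) / 45 * (N * (N - 1) / N ^+ 2 + 4 + 8 * (N - 1) / N ^+ 2) =
     (N - 1) / 45 * ((4 * (N - 1) * N + 24 * N + 8) / N) by field.
  by apply: mulr_ge0; apply: divr_ge0; nra.
have T1 : avg (fun s => `|T s|) <= 3 / q.
  by apply: (avg_norm_le O0) => //; rewrite divr_ge0// ltW.
have W1 : avg (fun s => `|W s|) <= 1.
  by apply: (avg_norm_le O0) => //; rewrite W2 expr1n.
have KE s : K s = (2 * m%:R * S2)^-1 * squared_increments s.
  rewrite /K /quadratic_variation /squared_increments -ss !mulr_sumr.
  apply: eq_bigr => ir _; rewrite /W -mulrBl exprMn exprVn; field.
  by rewrite M0 gt_eqF.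
(* The exchangeable identity for the identity function computes the mean of K. *)
have avgK : 1 - avg K = avg (fun s => T s * W s).
  have := exchangeable_identity (@exchangeK n m) WT id.
  have -> : avg (fun s => m%:R^-1 / 2 *
     \sum_j (W (exchange j s) - W s) * (W (exchange j s) - W s)) = avg K.
    by apply: eq_avg => s; congr (_ * _); apply: eq_bigr => j _; rewrite expr2.
  move=> ->; rewrite -W2 -avgB; apply: eq_avg => s; ring.
have avgK1 : `|1 - avg K| <= 3 / q.
  rewrite avgK; apply: le_trans (avg_norm _) _.
  apply: (@le_trans _ _ (avg (fun s => q / 6 * T s ^+ 2 + 3 / (2 * q) * W s ^+ 2))).
    apply: le_avg => s; rewrite normrM -(real_normK (num_real (T s))).
    rewrite -(real_normK (num_real (W s))); move: `|T s| `|W s| => a b.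
    rewrite -subr_ge0.
    have -> : q / 6 * a ^+ 2 + 3 / (2 * q) * b ^+ 2 - a * b =
        (q / 6) * (a - 3 / q * b) ^+ 2 by field; rewrite gt_eqF.
    by rewrite mulr_ge0 ?sqr_ge0 ?divr_ge0// ltW.
  rewrite avgD !avgZ W2 mulr1.
  have : q / 6 * avg (fun s => T s ^+ 2) <= q / 6 * (3 / q) ^+ 2.
    by rewrite ler_wpM2l// divr_ge0// ltW.
  have -> : q / 6 * (3 / q) ^+ 2 = 3 / (2 * q) by field; rewrite gt_eqF.
  have -> : 3 / q = 3 / (2 * q) + 3 / (2 * q) by field; rewrite gt_eqF.
  lra.
have varK : avg (fun s => `|K s - avg K|) <= 111 / q.
  apply: (avg_norm_le O0); first by rewrite divr_ge0// ltW.
  have -> : avg (fun s => (K s - avg K) ^+ 2) = (2 * m%:R * S2)^-1 ^+ 2 *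
     avg (fun s => (squared_increments s - avg squared_increments) ^+ 2).
    rewrite -avgZ; apply: eq_avg => s; rewrite (eq_avg KE) avgZ KE; ring.
  have M1 : 0 < m%:R :> R by rewrite ltr0n.
  have h0 : 0 < 2 * m%:R * S2 by apply: mulr_gt0 => //; rewrite mulr_gt0.
  rewrite exprVn mulrC ler_pdivrMr ?exprn_gt0//.
  apply: le_trans (variance_squared_increments nm) _.
  have -> : (2 * m%:R * S2) ^+ 2 = 2 ^+ 2 * (n%:R ^+ 2) ^+ 2 * S2 ^+ 2.
    by rewrite ME; ring.
  rewrite [(111 / q) ^+ 2]exprMn exprVn qq ME.
  have N0 : n%:R != 0 :> R by rewrite gt_eqF//; lra.
  have S4 : (n%:R ^+ 3 / 45) ^+ 2 <= S2 ^+ 2.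
    by rewrite ler_pXn2r// nnegrE ?(ltW S20)// divr_ge0// exprn_ge0.
  apply: (@le_trans _ _ (111 ^+ 2 / n%:R * (2 ^+ 2 * (n%:R ^+ 2) ^+ 2 * (n%:R ^+ 3 / 45) ^+ 2))).
    have -> : 111 ^+ 2 / n%:R * (2 ^+ 2 * (n%:R ^+ 2) ^+ 2 * (n%:R ^+ 3 / 45) ^+ 2) =
      (222 / 45) ^+ 2 * n%:R ^+ 9 :> R by field.
    rewrite -exprM -mulrA -exprD ler_wpM2r ?exprn_ge0//.
    have : 49 / 10 <= 222 / 45 :> R by lra.
    by move: (222 / 45) => a; nra.
  rewrite ler_wpM2l ?divr_ge0// ?exprn_ge0//.
  by rewrite ler_wpM2l// mulr_ge0// !exprn_ge0.
have K1 : avg (fun s => `|1 - K s|) <= 114 / q.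
  apply: (@le_trans _ _ (avg (fun s => `|K s - avg K| + `|1 - avg K|))).
    apply: le_avg => s; rewrite -[in leRHS]normrN opprB.
    by apply: le_trans (ler_normD _ _); rewrite [_ + (1 - _)]addrC addrA subrK.
  rewrite avgD (avg_cst O0).
  have -> : 114 / q = 111 / q + 3 / q by rewrite -mulrDl; congr (_ / _); lra.
  exact: lerD.
have K_le s : K s <= 49 / 2.
  apply: (@le_trans _ _ (m%:R^-1 / 2 * \sum_(ir : 'I_n * 'I_m) (7 / q) ^+ 2)).
    rewrite ler_wpM2l ?divr_ge0//; apply: ler_sum => ir _.
    rewrite -(real_normK (num_real (W (exchange ir s) - W s))).
    by rewrite ler_pXn2r// nnegrE// divr_ge0// ltW.
  rewrite sumr_const card_prod !card_ord -[X in _ * X]mulr_natl natrM exprMn exprVn qq.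
  have N0 : n%:R != 0 :> R by rewrite gt_eqF//; lra.
  have -> : m%:R^-1 / 2 * (n%:R * m%:R * (7 ^+ 2 / n%:R)) = 49 / 2 :> R.
    by field; rewrite M0 N0.
  exact: lexx.
have d0 : 0 <= 7 / q by rewrite divr_ge0// ltW.
apply: le_trans (stein_exchangeable_pair (@exchangeK n m) c0 WT O0 D_le K_le K1 T1 W1 d0 x) _.
rewrite -/q; apply: (@le_trans _ _ (921 / q)); last first.
  by rewrite ler_wpM2r ?invr_ge0 ?(ltW q0)// ler_nat.
rewrite -subr_ge0.
have -> : 921 / q - (114 / q + 3 * (3 / q) + 4 * (49 / 2) * (7 / q) + 4 * (7 / q) * (1 + 3 / q))
  = 84 * (q - 1) / q ^+ 2 by field; rewrite gt_eqF.
by rewrite divr_ge0 ?exprn_ge0 ?(ltW q0)//; lra.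
Qed.

End ExchangeableChords.

(** * From quadruples of vertices to crossing signs *)

(** Of the eight ways to name the endpoints a, b of one edge and c, d of the other
    in the order a > c > b > d, exactly one is realized when the edges cross and
    none otherwise. *)
Lemma crossing_namings (a0 a1 c0 c1 : nat) :
  a0 != a1 -> c0 != c1 -> a0 != c0 -> a0 != c1 -> a1 != c0 -> a1 != c1 ->
  (([&& c0 < a0, a1 < c0 & c1 < a1] + [&& c1 < a0, a1 < c1 & c0 < a1] +
    [&& c0 < a1, a0 < c0 & c1 < a0] + [&& c1 < a1, a0 < c1 & c0 < a0]) +
   ([&& a0 < c0, c1 < a0 & a1 < c1] + [&& a1 < c0, c1 < a1 & a0 < c1] +
    [&& a0 < c1, c0 < a0 & a1 < c0] + [&& a1 < c1, c0 < a1 & a0 < c0]))%N =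
  ((a0 < c0) (+) (a0 < c1) (+) ((a1 < c0) (+) (a1 < c1)))%N.
Proof.
by move=> *; case: (ltngtP a0 c0); case: (ltngtP a0 c1); case: (ltngtP a1 c0);
  case: (ltngtP a1 c1); lia.
Qed.

Section CountCrossings.
Context {R : realType} (n : nat).
Variable v : 'I_n * bool -> nat.
Hypothesis vI : injective v.

Definition ordered_crossing (i j : 'I_n) (b c : bool) : bool :=
  [&& (v (j, c) < v (i, b))%N, (v (i, ~~ b) < v (j, c))%N &
      (v (j, ~~ c) < v (i, ~~ b))%N].

Lemma ordered_crossing_diag i b c : ordered_crossing i i b c = false.
Proof.
by rewrite /ordered_crossing; case: b c => -[] /=; rewrite ?ltnn ?andbF.
Qed.

(** Each crossing pair of chords is named once, in one of its two orders. *)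
Lemma ordered_crossing_pair i j : i != j ->
  \sum_b \sum_c ((ordered_crossing i j b c)%:R + (ordered_crossing j i b c)%:R) =
  (1 - crossing_sign v i j) / 2 :> R.
Proof.
move=> ij.
have ne x y : x != y -> v x != v y by move=> xy; rewrite (inj_eq vI).
have nb k : v (k, true) != v (k, false) by apply: ne; rewrite xpair_eqE andbF.
have nij b c : v (i, b) != v (j, c) by apply: ne; rewrite xpair_eqE (negPf ij).
have := crossing_namings (nb i) (nb j) (nij _ _) (nij _ _) (nij _ _) (nij _ _).
rewrite crossing_signE /sgn -!signr_addb.
set X := (_ (+) _ (+) _) => H.
transitivity (X%:R : R); last first.
  by case: (X); rewrite /= ?expr1 ?expr0; field.
by rewrite -H !big_bool /ordered_crossing /= !natrD; ring.
Qed.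

Lemma count_ordered_crossings :
  \sum_i \sum_j \sum_b \sum_c (ordered_crossing i j b c)%:R =
  n%:R * (n%:R - 1) / 6 + centered_crossings R v.
Proof.
pose S (i j : 'I_n) : R := \sum_b \sum_c (ordered_crossing i j b c)%:R.
have S0 i : S i i = 0.
  by rewrite /S big1// => b _; rewrite big1// => c _; rewrite ordered_crossing_diag.
have SS i j : i != j -> S i j + S j i = (1 - crossing_sign v i j) / 2.
  move=> ij; rewrite -ordered_crossing_pair// /S -big_split; apply: eq_bigr => b _ /=.
  by rewrite -big_split.
transitivity (\sum_i \sum_(j | j != i) S i j).
  by apply: eq_bigr => i _; rewrite (bigD1 i)//= -/(S i i) S0 add0r.
have E : \sum_i \sum_(j | j != i) S i j = \sum_i \sum_(j | j != i) S j i.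
  rewrite (exchange_big_dep xpredT)//=; apply: eq_bigr => i _.
  by apply: eq_bigl => j; rewrite eq_sym.
have : 2 * \sum_i \sum_(j | j != i) S i j =
   \sum_i \sum_(j | j != i) (1 - crossing_sign v i j) / 2.
  rewrite mulr_natl mulr2n {2}E -big_split; apply: eq_bigr => i _ /=.
  by rewrite -big_split /=; apply: eq_bigr => j ji; rewrite SS// eq_sym.
have -> : \sum_i \sum_(j | j != i) (1 - crossing_sign v i j) / 2 =
   1 / 3 * (n%:R * (n%:R - 1)) -
   1 / 2 * \sum_i \sum_(j | j != i) (crossing_sign v i j - 1 / 3) :> R.
  have -> : n%:R * (n%:R - 1) = \sum_(i < n) \sum_(j | j != i) 1 :> R.
    by under eq_bigr do rewrite sum_other; rewrite sumr_const card_ord mulr_natl.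
  rewrite !mulr_sumr -sumrB; apply: eq_bigr => i _.
  by rewrite !mulr_sumr -sumrB; apply: eq_bigr => j _; field.
rewrite /centered_crossings.
move: (\sum_i \sum_(j | j != i) S i j) => A.
move: (\sum_i \sum_(j | j != i) (crossing_sign v i j - 1 / 3)) => B; lra.
Qed.

End CountCrossings.

Section Matching.
Context {R : realType} (n : nat) (G : sgraph 'I_(2 * n)).

Lemma matching_labels : isomorphic G (disjoint_copies n (complete_graph 2)) ->
  exists2 e : 'I_n * bool -> 'I_(2 * n), bijective e &
    forall i b j c, G (e (i, b)) (e (j, c)) = (i == j) && (b != c).
Proof.
move=> [f [[g fK gK] fG]].
pose o (b : bool) : 'I_2 := if b then ord_max else ord0.
have oI : injective o by move=> [] [].
have oK (k : 'I_2) : o (k == ord_max) = k.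
  by apply/val_inj; case: k => -[|[|]].
exists (fun x => g (x.1, o x.2)).
  exists (fun y => ((f y).1, (f y).2 == ord_max)) => [[i b]|y] /=.
    by rewrite gK /=; congr (_, _); case: b.
  by rewrite oK -surjective_pairing fK.
by move=> i b j c; rewrite -fG !gK /= (inj_eq oI).
Qed.

Variable e : 'I_n * bool -> 'I_(2 * n).
Hypothesis eB : bijective e.
Hypothesis eG : forall i b j c, G (e (i, b)) (e (j, c)) = (i == j) && (b != c).

Lemma sum_over_labels (F : 'I_(2 * n) -> R) :
  \sum_a F a = \sum_i \sum_b F (e (i, b)).
Proof. by rewrite (reindex e); [exact: sum_pair|exact: onW_bij]. Qed.

Lemma sum_over_edges i b (F : 'I_(2 * n) -> R) :
  \sum_(a | G (e (i, b)) a) F a = F (e (i, ~~ b)).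
Proof.
rewrite big_mkcond sum_over_labels (bigD1 i)//= big_bool /= !eG eqxx /=.
rewrite big1 ?addr0 => [|j ji]; last first.
  by rewrite big1// => c _; rewrite eG eq_sym (negPf ji).
by case: b => /=; rewrite ?addr0 ?add0r.
Qed.

Lemma crossing_countE (s : 'S_(2 * n)) :
  crossing_count R G s = n%:R * (n%:R - 1) / 6 +
    centered_crossings R (fun x => nat_of_ord (s (e x))).
Proof.
have vI : injective (fun x => nat_of_ord (s (e x))).
  by move=> x y /val_inj /perm_inj /(bij_inj eB).
rewrite -(count_ordered_crossings vI) /crossing_count -sum1_card natr_sum.
pose T (a b c d : 'I_(2 * n)) : R := [&& s c < s a, s b < s c & s d < s b]%N%:R.
transitivity (\sum_a \sum_(b | G a b) \sum_c \sum_(d | G c d) T a b c d).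
  rewrite big_mkcond !sum_pair /=; apply: eq_bigr => a _.
  rewrite [RHS]big_mkcond /=; apply: eq_bigr => b _.
  case ab : (G a b); last first.
    by rewrite big1// => c _; rewrite big1// => d _; rewrite inE ab.
  apply: eq_bigr => c _; rewrite [RHS]big_mkcond /=; apply: eq_bigr => d _.
  by rewrite inE ab /T; case: (G c d) => //=; case: andP.
rewrite sum_over_labels; apply: eq_bigr => i _.
transitivity (\sum_b \sum_j \sum_c
    (ordered_crossing (fun x => nat_of_ord (s (e x))) i j b c)%:R : R).
  apply: eq_bigr => b _; rewrite sum_over_edges sum_over_labels.
  by apply: eq_bigr => j _; apply: eq_bigr => c _; rewrite sum_over_edges.
by rewrite exchange_big.
Qed.

End Matching.

(** * Functions of a uniformly random permutation *)

Section UniformPermutation.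
Context {d : measure_display} {T : measurableType d} {R : realType}
  {P : probability T R} (N : nat) (pi : {RV P >-> 'S_N}).
Hypothesis pi_unif : uniform_permutation pi.

Lemma expectation_uniform (f : 'S_N -> R) : (forall s, 0 <= f s) ->
  'E_P[f \o pi]%E = (avg f)%:E.
Proof.
move=> f0; rewrite unlock.
have mpi s : measurable (pi @^-1` [set s]).
  exact: (measurable_funPTI pi).
transitivity (\int[P]_w (\sum_(s : 'S_N) (f s)%:E * (\1_(pi @^-1` [set s]) w)%:E))%E.
  apply: eq_integral => w _ /=.
  rewrite (bigD1 (pi w))//= indicE mem_set// mule1 big1 ?adde0// => s sw.
  rewrite indicE memNset ?mule0// => /= E.
  by rewrite E eqxx in sw.
rewrite ge0_integral_sum//; last 2 first.
- move=> s; apply: measurable_funeM; apply/measurable_EFinP.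
  exact: measurable_indic.
- by move=> s w _; rewrite mule_ge0// lee_fin.
rewrite /avg mulr_sumr -sumEFin; apply: eq_bigr => s _.
rewrite ge0_integralZl//=; last 2 first.
- by apply/measurable_EFinP; exact: measurable_indic.
- by rewrite lee_fin.
rewrite integral_indic// setIT.
have := pi_unif s; rewrite /distribution /pushforward /= => ->.
by rewrite -EFinM card_Sn mulrC.
Qed.

Lemma probability_uniform (B : {set 'S_N}) :
  P (pi @^-1` [set s | s \in B]) = (avg (fun s => (s \in B)%:R))%:E.
Proof.
rewrite -expectation_uniform//.
have mB : measurable (pi @^-1` [set s | s \in B]) by exact: (measurable_funPTI pi).
rewrite -(expectation_indic P mB); congr ('E_P[_])%E; apply/funext => w /=.
rewrite indicE /=; congr (_%:R); congr nat_of_bool.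
by apply/idP/idP; [rewrite inE|move=> ?; rewrite inE].
Qed.

End UniformPermutation.

(** * Normal approximation of the number of crossings *)

(** Averages over the embeddings of the matching are averages over the orders of
    the endpoints, in which further chords may take part. *)
Lemma avg_diagram (R : realType) (n : nat) (K : finType) (k : K -> nat)
    (e : 'I_n * bool -> K) (F : R -> R) : injective k -> injective e ->
  avg (fun s : {perm K} => F (centered_crossings R (fun x => k (s (e x))))) =
  avg (fun s : {perm 'I_n * bool} =>
    F (centered_crossings R (fun x => nat_of_ord (enum_rank (s x))))).
Proof.
move=> kI eI.
apply: (@avg_restrict R _ _ (fun x => nat_of_ord (enum_rank x)) k e
  (fun v => F (centered_crossings R v))) => //.
- by move=> a b /val_inj /enum_rank_inj.
- by move=> v w vw; rewrite (eq_centered_crossings R vw).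
Qed.

Section MatchingMoments.
Context {R : realType} (n : nat) (e : 'I_n * bool -> 'I_(2 * n)).
Hypothesis eI : injective e.
Local Notation C s := (centered_crossings R (fun x => nat_of_ord (s (e x)))).

Let rankI : injective (fun x : 'I_n * bool => nat_of_ord (enum_rank x)).
Proof. by move=> a b /val_inj /enum_rank_inj. Qed.

Lemma matching_mean : avg (fun s : 'S_(2 * n) => C s) = 0.
Proof.
by rewrite (avg_diagram id val_inj eI) (@avg_centered_crossings R n _ rankI).
Qed.

Lemma matching_variance : (0 < n)%N ->
  avg (fun s : 'S_(2 * n) => C s ^+ 2) = n%:R * (n%:R - 1) * (n%:R + 3) / 45.
Proof.
move=> n0; rewrite (avg_diagram (fun x => x ^+ 2) val_inj eI).
exact: (@variance_crossings R n _ rankI).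
Qed.

Lemma matching_kolmogorov x : (1 < n)%N ->
  `|avg (fun s : 'S_(2 * n) =>
       (C s / Num.sqrt (n%:R * (n%:R - 1) * (n%:R + 3) / 45) <= x)%R%:R)
    - gauss_cdf x| <= 1868 / Num.sqrt n%:R.
Proof.
move=> n1; set sigma := Num.sqrt (_ / 45).
rewrite (avg_diagram (fun c => (c / sigma <= x)%R%:R) val_inj eI).
pose K := (('I_n + 'I_(n * n)) * bool)%type.
have kI : injective (fun x : K => nat_of_ord (enum_rank x)).
  by move=> a b /val_inj /enum_rank_inj.
have jI : injective (fun x : 'I_n * bool => (inl x.1, x.2) : K).
  by move=> [a b] [c d] [-> ->].
rewrite -(avg_diagram (fun c => (c / sigma <= x)%R%:R) kI jI).
exact: (@kolmogorov_diagram R n (n * n) _ kI x n1).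
Qed.

End MatchingMoments.

Theorem mainTheorem9 (R : realType) (n : nat) (n_ge2 : (2 <= n)%N)
    (G : sgraph 'I_(2 * n))
    (G_matching : isomorphic G (disjoint_copies n (complete_graph 2)))
    (d : measure_display) (T : measurableType d) (P : probability T R)
    (pi : {RV P >-> 'S_(2 * n)}) (pi_unif : uniform_permutation pi)
    (d' : measure_display) (T' : measurableType d') (P' : probability T' R)
    (Z : {RV P' >-> R}) (Z_normal : standard_normal Z) :
  let X : {RV P >-> R} := crossing_number G pi in
  let W : {RV P >-> R} := standardize X in
  [/\ 'E_P[X]%E = (n%:R * (n%:R - 1) / 6)%:E,
      'V_P[X]%E = (n%:R * (n%:R - 1) * (n%:R + 3) / 45)%:E
    & (kolmogorov_distance W Z <= (1868 / Num.sqrt n%:R)%:E)%E].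
Proof.
move=> X W.
have n0 : (0 < n)%N by exact: ltnW.
have [e eB eG] := matching_labels G_matching.
have eI := bij_inj eB.
pose C s := centered_crossings R (fun x => nat_of_ord ((s : 'S_(2 * n)) (e x))).
have XE s : crossing_count R G s = n%:R * (n%:R - 1) / 6 + C s.
  exact: crossing_countE.
have EX : 'E_P[X]%E = (n%:R * (n%:R - 1) / 6)%:E.
  rewrite (expectation_uniform pi_unif (f := crossing_count R G))//; congr _%:E.
  rewrite (eq_avg XE) avgD (avg_cst (perm_gt0 _)) -[RHS]addr0; congr (_ + _).
  exact: matching_mean.
have VX : 'V_P[X]%E = (n%:R * (n%:R - 1) * (n%:R + 3) / 45)%:E.
  rewrite /variance unlock EX /=.
  transitivity ('E_P[(fun s => (C s ^+ 2)%R) \o pi])%E.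
    congr ('E_P[_])%E; apply/funext => w /=.
    have XC : crossing_count R G (pi w) - n%:R * (n%:R - 1) / 6 = C (pi w).
      by rewrite XE addrC addKr.
    by rewrite -XC expr2.
  rewrite (expectation_uniform pi_unif) => [|s]; last exact: sqr_ge0.
  by rewrite matching_variance.
split => //; apply: ge_ereal_sup => _ [x _ <-].
have -> : cdf Z x = (gauss_cdf x)%:E.
  rewrite /cdf Z_normal; last by [].
  by rewrite /gauss_cdf fineK// fin_num_measure.
pose sigma : R := Num.sqrt (n%:R * (n%:R - 1) * (n%:R + 3) / 45).
have -> : cdf W x = (avg (fun s => (C s / sigma <= x)%R%:R))%:E.
  transitivity (P (pi @^-1` [set s | s \in [set s | C s / sigma <= x]%SET])).
    rewrite /cdf /distribution /pushforward /=; congr (P _); apply/funext => w /=.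
    rewrite in_itv /= inE /standardize EX VX; congr (is_true (_ / _ <= _)).
    by rewrite [X w]XE addrC addKr.
  rewrite (probability_uniform pi_unif); congr _%:E.
  by apply: eq_avg => s; rewrite inE.
by rewrite -EFinB abse_EFin lee_fin; exact: matching_kolmogorov.
Qed.
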